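(* There exists a symmetric Banach function lattice $(X,\|\cdot\|_X)$ on $(0,\infty)$ with the following properties: (1) If $v\in X$, $u\in L_{\log_+}(0,\infty)$, and $u\prec\!\prec_{\log} v$, then $u\in X$ and $\|u\|_X\le\|v\|_X$. (2) The norm on $X$ is strongly symmetric. (3) There are nonnegative decreasing functions $f\in X$ and $g\notin X$ such that $$g\prec\!\prec f,\qquad \|f\|_{M_\psi}=\|g\|_{M_\psi}=1.$$ Consequently, there exists no fully symmetric norm on $X$ which is equivalent to $\|\cdot\|_X$.
   Context: $L_0(0,\infty)$ is the vector lattice of all real- or complex-valued Lebesgue measurable functions on $(0,\infty)$ that are finite almost everywhere, modulo a.e. equality, with pointwise a.e. order. For $h\in L_0(0,\infty)$, $h^*$ denotes the decreasing rearrangement of $|h|$. ''Decreasing'' means non-increasing. Hardy--Littlewood submajorization: $u\prec\!\prec v$ means $\int_0^t u^*(s)\,ds\le\int_0^t v^*(s)\,ds$ for all $t>0$. Logarithmic submajorization: provided the positive parts of $\log u^*$ and $\log v^*$ are locally integrable (integrable over $(0,t)$ for each finite $t>0$), $u\prec\!\prec_{\log} v$ means $\int_0^t\log u^*(s)\,ds\le\int_0^t\log v^*(s)\,ds$ for all $t>0$, where $\log 0=-\infty$ and integrals are extended integrals in $[-\infty,\infty)$. $L_{\log_+}(0,\infty)=\{h:\ \log_+h^*\in (L_1+L_\infty)(0,\infty)\}$, where $\log_+t=\max\{\log t,0\}$ for $t>0$ and $\log_+0=0$. A Banach lattice $E\subset L_0(0,\infty)$ is symmetric if, whenever $v\in E$,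 $u\in L_0(0,\infty)$ and $u^*\le v^*$, one has $u\in E$ and $\|u\|_E\le\|v\|_E$. It is strongly symmetric if $u,v\in E$ and $u\prec\!\prec v$ imply $\|u\|_E\le\|v\|_E$. It is fully symmetric if $u\in L_0(0,\infty)$, $v\in E$ and $u\prec\!\prec v$ imply $u\in E$ and $\|u\|_E\le\|v\|_E$. $\psi(t)=t$ for $0<t\le1$ and $\psi(t)=1+\log t$ for $t>1$. The Marcinkiewicz space is $M_\psi=M_\psi(0,\infty)=\{h\in L_0(0,\infty):\ \|h\|_{M_\psi}:=\sup_{t>0}\frac{1}{\psi(t)}\int_0^t h^*(s)\,ds<\infty\}$. *)

(* Defs.v *)
From mathcomp Require Import all_boot all_order all_algebra.
From mathcomp Require Import complex.
From mathcomp Require Import all_classical all_reals all_analysis.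

Set Implicit Arguments.
Unset Strict Implicit.
Unset Printing Implicit Defensive.

Import Order.TTheory GRing.Theory Num.Theory.
Import numFieldNormedType.Exports.

Local Open Scope classical_set_scope.
Local Open Scope ring_scope.

(* Function spaces are taken over the reals or over the complex numbers,
   according to a parameter [k]. *)
Variant scalar_kind := RealScalars | ComplexScalars.

Definition scalar_field (R : realType) (k : scalar_kind) : numFieldType :=
  match k with
  | RealScalars => R : numFieldType
  | ComplexScalars => R[i] : numFieldType
  end.

Definition sc_re (R : realType) (k : scalar_kind) : scalar_field R k -> R :=
  match k return scalar_field R k -> R with
  | RealScalars => fun x : R => x
  | ComplexScalars => fun z : R[i] => complex.Re z
  end.

Definition sc_im (R : realType) (k : scalar_kind) : scalar_field R k -> R :=
  match k return scalar_field R k -> R with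
  | RealScalars => fun _ : R => 0
  | ComplexScalars => fun z : R[i] => complex.Im z
  end.

Definition sc_of_real (R : realType) (k : scalar_kind) : R -> scalar_field R k :=
  match k return R -> scalar_field R k with
  | RealScalars => fun x => x
  | ComplexScalars => fun x => Complex x 0
  end.

(* The norm of a numFieldType takes its values in the field itself (hence in
   R[i] for complex scalars); [sc_re] brings it back to R. *)
Definition sc_abs (R : realType) (k : scalar_kind) (z : scalar_field R k) : R :=
  sc_re `|z|.

(* The real line with the sigma-algebra of all Lebesgue measurable sets, on
   which [completed_lebesgue_measure] is defined ([lebesgue_measure] is the
   restriction of the latter to the Borel sets). *)
Definition LebesgueR (R : realType) : measurableType _ :=
  caratheodory_type (wlength (@idfun R))^*%mu.

Section lebesgue_functions.
Variables (R : realType) (k : scalar_kind).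
Local Notation K := (scalar_field R k).
Local Notation mu := (@completed_lebesgue_measure R).

(* Elements of L_0(0, +oo) are represented by functions on the whole line whose
   values outside (0, +oo) are irrelevant; two such functions represent the
   same element when they agree for a.e. x > 0. *)
Definition ae_pos (P : R -> Prop) : Prop :=
  {ae mu, forall x : LebesgueR R, 0 < (x : R) -> P x}.

Definition L0 : set (R -> K) := [set u |
  measurable_fun (`]0, +oo[ : set (LebesgueR R)) (fun x => sc_re (u x)) /\
  measurable_fun (`]0, +oo[ : set (LebesgueR R)) (fun x => sc_im (u x))].

Definition distribution (h : R -> K) (s : R) : \bar R :=
  mu [set x : LebesgueR R | 0 < (x : R) /\ s < sc_abs (h x)].

Definition rearr (h : R -> K) (t : R) : \bar R :=
  ereal_inf [set s%:E | s in
    [set s : R | 0 <= s /\ (distribution h s <= t%:E)%E]].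

Definition int0t (F : R -> \bar R) (t : R) : \bar R :=
  integral mu (`]0, t[ : set (LebesgueR R)) F.

Definition submaj (u v : R -> K) : Prop :=
  forall t : R, 0 < t -> (int0t (rearr u) t <= int0t (rearr v) t)%E.

Definition log_plus (x : \bar R) : \bar R := maxe (lne x) 0%E.

Definition loc_integrable0 (F : R -> \bar R) : Prop :=
  forall t : R, 0 < t -> mu.-integrable (`]0, t[ : set (LebesgueR R)) F.

Definition log_submaj (u v : R -> K) : Prop :=
  [/\ loc_integrable0 (fun s => log_plus (rearr u s)),
      loc_integrable0 (fun s => log_plus (rearr v s)) &
      forall t : R, 0 < t ->
        (int0t (fun s => lne (rearr u s)) t <=
         int0t (fun s => lne (rearr v s)) t)%E].

Definition L1_plus_Loo (F : R -> \bar R) : Prop :=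
  exists a b : R -> R,
    [/\ mu.-integrable (`]0, +oo[ : set (LebesgueR R)) (EFin \o a),
        measurable_fun (`]0, +oo[ : set (LebesgueR R)) b,
        (exists M : R, ae_pos (fun x => `|b x| <= M)) &
        ae_pos (fun x => F x = (a x + b x)%:E)].

Definition L_log_plus : set (R -> K) :=
  [set h | L0 h /\ L1_plus_Loo (fun s => log_plus (rearr h s))].

Definition psi (t : R) : R := if t <= 1 then t else 1 + ln t.

Definition Marcinkiewicz_norm (h : R -> K) : \bar R :=
  ereal_sup [set ((psi t)^-1%:E * int0t (rearr h) t)%E
            | t in [set t : R | 0 < t]].

End lebesgue_functions.

Section banach_lattices.
Variables (R : realType) (k : scalar_kind).
Local Notation K := (scalar_field R k).
Implicit Types (X : set (R -> K)) (N : (R -> K) -> R).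

(* Values of [N] outside [X] are irrelevant. [bl_re] is trivial over the reals;
   over the complex numbers it says that [X] is the complexification of the
   vector lattice of its real-valued elements. *)
Record banach_lattice X N : Prop := BanachLattice {
  bl_sub : X `<=` @L0 R k ;
  bl_ae : forall u v, X u -> L0 v -> ae_pos (fun x => u x = v x) ->
    X v /\ N v = N u ;
  bl_0 : X (fun=> 0) ;
  bl_add : forall u v, X u -> X v -> X (fun x => u x + v x) ;
  bl_scale : forall (a : K) u, X u -> X (fun x => a * u x) ;
  bl_abs : forall u, X u -> X (fun x => sc_of_real k (sc_abs (u x))) ;
  bl_re : forall u, X u -> X (fun x => sc_of_real k (sc_re (u x))) ;
  bl_norm_ge0 : forall u, X u -> 0 <= N u ;
  bl_norm_eq0 : forall u, X u -> (N u = 0 <-> ae_pos (fun x => u x = 0)) ;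
  bl_normD : forall u v, X u -> X v -> N (fun x => u x + v x) <= N u + N v ;
  bl_normZ : forall (a : K) u, X u -> N (fun x => a * u x) = sc_abs a * N u ;
  bl_monotone : forall u v, X u -> X v ->
    ae_pos (fun x => sc_abs (u x) <= sc_abs (v x)) -> N u <= N v ;
  bl_complete : forall w : nat -> R -> K, (forall n, X (w n)) ->
    (forall e : R, 0 < e -> exists n0 : nat, forall m n : nat,
      (n0 <= m)%N -> (n0 <= n)%N -> N (fun x => w m x - w n x) < e) ->
    exists2 l, X l & (fun n => N (fun x => w n x - l x)) @ \oo --> (0 : R) }.

Definition symmetric_lattice X N : Prop :=
  banach_lattice X N /\
  forall u v, X v -> L0 u -> (forall t : R, 0 < t -> (rearr u t <= rearr v t)%E) ->
    X u /\ N u <= N v.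

Definition strongly_symmetric X N : Prop :=
  banach_lattice X N /\
  forall u v, X u -> X v -> submaj u v -> N u <= N v.

Definition fully_symmetric X N : Prop :=
  banach_lattice X N /\
  forall u v, L0 u -> X v -> submaj u v -> X u /\ N u <= N v.

Definition equivalent_norms X N1 N2 : Prop :=
  exists c C : R, [/\ 0 < c, 0 < C &
    forall u, X u -> c * N1 u <= N2 u /\ N2 u <= C * N1 u].

End banach_lattices.

Definition nonneg_decreasing (R : realType) (f : R -> R) : Prop :=
  (forall x, 0 < x -> 0 <= f x) /\
  (forall x y, 0 < x -> x <= y -> f y <= f x).

(* Main.v *)
Require Import Defs.
From mathcomp Require Import all_boot all_order all_algebra.
From mathcomp Require Import all_classical all_reals all_analysis.
From mathcomp Require Import complex lra ring measurable_realfun.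

(** Let [M] be the Marcinkiewicz space of [psi], where [psi t = t] on [(0, 1]]
    and [psi t = 1 + ln t] beyond, and let [S u t = \int_0^t sqrt (u^* )].  By
    the inequality of Cauchy and Schwarz, [S u t <= sqrt (t * psi t)] on the
    unit ball of [M].  The space is the set of the [u] in [M] for which [S u]
    has a smaller order along a sparse sequence of points [m n]: [S u (m n) = o (sqrt (m n * psi (m n)))], with the
    norm of [M].

    It is a closed sublattice of [M] because [u |-> \int_0^t u^*] is
    subadditive ([rearr_integralD], from the formula
    [\int_0^t u^* = min_l (l t + \int (|u| - l)^+)]), because
    [sqrt |u + v| <= sqrt |u| + sqrt |v|], and because the root means of a
    function of norm at most [e] are at most [sqrt e] times the extreme order
    ([rearr_integral_sqrt_le_psi_norm]).  As [psi t = t] near zero, the norm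
    dominates the essential supremum, so that completeness reduces to uniform
    convergence off a null set.  The norm is monotone for submajorization by
    its very form.

    Logarithmic submajorization of [u] by [v] passes to all powers, since taking
    a power multiplies the logarithm by a constant; and it implies
    submajorization ([weyl]).  For the first power this controls the norm, for
    the power one half it controls [S].  So it preserves the space.

    Submajorization does not control [S].  Take the decreasing step functions
    with heights [c * L n / exp (L n)] on successive blocks with ends
    [exp (L n)], where [L n] grows geometrically with ratio 16.  The mass up to
    the end of the block number [n] is of order [L n], that is of order [psi].
    At the end [t] of a block the function is of order [psi t / t] on all of [(0, t)]
    up to a negligible part, so that [S] has the extreme order there.  Deep
    inside a block it has a much smaller order.  With [f] given by
    [L n = 16 ^ n], [g] by [L n = 4 * 16 ^ n], and [m n = exp (4 * 16 ^ n)], [f]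
    belongs to the space ([small_f_step]) and [g] does not
    ([not_small_g_step]), although a small constant in the definition of [g]
    makes the mass of [g] on [(0, t)] at most that of [f] for every [t]
    ([submaj_steps]).  Both functions equal 1 on [(0, 1)] and have norm 1.
    A fully symmetric norm on the space would force [g] into it.

    The measure theory is done on a measure space [T] with a coordinate [r] for
    which the set [0 < r < t] has measure [t]; the half-line with the Lebesgue
    sigma-algebra is the instance [toR]. *)

Set Implicit Arguments.
Unset Strict Implicit.
Unset Printing Implicit Defensive.
Import Order.TTheory GRing.Theory Num.Theory.
Import numFieldNormedType.Exports.
Local Open Scope classical_set_scope.
Local Open Scope ring_scope.

(** * Level sets and decreasing rearrangements *)

Section rearrangement.
Variables (d : measure_display) (T : measurableType d) (R : realType).
Variables (mu : {sigma_finite_measure set T -> \bar R}) (r : T -> R).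
Hypothesis mr : measurable_fun setT r.
Hypothesis mu_r : forall t : R, 0 <= t -> mu (r @^-1` `]0, t[) = t%:E.

Definition half_line : set T := r @^-1` `]0, +oo[.
Local Notation pos := half_line.
Definition initial (t : R) : set T := r @^-1` `]0, t[.

Lemma measurable_preimage_itv (i : interval R) : measurable (r @^-1` [set` i]).
Proof. by rewrite -[X in measurable X]setTI; exact: mr. Qed.

Lemma measurable_half_line : measurable pos.
Proof. exact: measurable_preimage_itv. Qed.

Lemma measurable_initial (t : R) : measurable (initial t).
Proof. exact: measurable_preimage_itv. Qed.

Local Hint Resolve measurable_half_line : core.
Local Hint Extern 0 (measurable (initial _)) => exact: measurable_initial : core.

Lemma half_lineE (x : T) : half_line x = (0 < r x) :> Prop.
Proof. by rewrite /half_line/preimage/= in_itv/= andbT. Qed.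

Lemma initialE (t : R) (x : T) : initial t x = (0 < r x < t) :> Prop.
Proof. by rewrite /initial/preimage/= in_itv. Qed.

Lemma initial_half_line (t : R) : initial t `<=` pos.
Proof. by move=> x; rewrite initialE half_lineE => /andP[]. Qed.

Lemma initialS (s t : R) : s <= t -> initial s `<=` initial t.
Proof.
by move=> st x; rewrite !initialE => /andP[-> /lt_le_trans]; exact.
Qed.

Lemma measure_half_line : mu pos = +oo%E.
Proof.
apply/eqyP => t t0; rewrite -mu_r; last exact: ltW.
by apply: le_measure; rewrite ?inE;
  [exact: measurable_initial|exact: measurable_half_line|exact: initial_half_line].
Qed.

Lemma measure_lt_ereal (e : \bar R) : (0 <= e)%E ->
  mu [set x | 0 < r x /\ ((r x)%:E < e)%E] = e.
Proof.
case: e => [t t0|_|//].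
  rewrite -[RHS]mu_r; last by rewrite -lee_fin.
  by congr (mu _); apply/seteqP; split => x/=; rewrite in_itv/= lte_fin => /andP.
rewrite -[RHS]measure_half_line; congr (mu _).
by apply/seteqP; split => x/=; rewrite half_lineE ltry//; case.
Qed.

Lemma measurable_nincr (f : R -> \bar R) (D : set T) : D `<=` pos ->
  (forall x y : R, 0 < x -> x <= y -> (f y <= f x)%E) ->
  measurable_fun D (fun x => f (r x)).
Proof.
move=> Dpos f_ni.
apply: (measurable_funS measurable_half_line Dpos).
have mf : measurable_fun (`]0, +oo[ : set R) f.
  apply: measurability; first exact: ErealGenOInfty.measurableE.
  move=> _ [_ [s ->] <-]; apply: is_interval_measurable.
  move=> a b [/= a0 sa] [b0 sb] c /andP[ac cb]; move: a0 sa b0 sb.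
  rewrite !in_itv/= !andbT => a0 sa b0 sb; split; first exact: lt_le_trans ac.
  by apply: lt_le_trans sb _; apply: f_ni => //; exact: lt_le_trans ac.
apply: (measurable_comp _ _ mf) => //; first by move=> _ [x xp <-].
exact: measurable_funTS.
Qed.

Implicit Types u v w : T -> R.

Definition level_measure w (s : R) : \bar R := mu [set x | 0 < r x /\ s < w x].

Definition rearrangement w (t : R) : \bar R :=
  ereal_inf [set s%:E | s in [set s : R | 0 <= s /\ (level_measure w s <= t%:E)%E]].

Local Notation dist := level_measure.
Local Notation rs := rearrangement.

Lemma measurable_level_set w (s : R) : measurable_fun pos w ->
  measurable [set x | 0 < r x /\ s < w x].
Proof.
move=> mw.
have -> : [set x | 0 < r x /\ s < w x] = pos `&` w @^-1` `]s, +oo[%classic.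
  by apply/seteqP; split => x /=; rewrite half_lineE in_itv/= andbT.
exact: mw.
Qed.

Lemma le_level_measure_ae u w (s : R) :
  measurable_fun pos u -> measurable_fun pos w ->
  {ae mu, forall x, 0 < r x -> u x <= w x} -> (dist u s <= dist w s)%E.
Proof.
move=> mu_ mw [N [mN N0 uwN]].
rewrite /dist -[leRHS]adde0 -N0.
apply: le_trans (measureU2 mu (measurable_level_set s mw) mN).
apply: le_measure; rewrite ?inE.
- exact: measurable_level_set.
- by apply: measurableU => //; exact: measurable_level_set.
- move=> x [x0 sx]; have [xN|xN] := pselect (N x); first by right.
  left; split => //; apply: lt_le_trans sx _.
  by apply: contrapT => h; apply/xN/uwN => /= /(_ x0).
Qed.

Lemma level_measure_nincr w (s s' : R) : measurable_fun pos w ->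
  s <= s' -> (dist w s' <= dist w s)%E.
Proof.
move=> mw ss'; apply: le_measure; rewrite ?inE; [exact: measurable_level_set..|].
by move=> x [x0 sx]; split => //; exact: le_lt_trans sx.
Qed.

(** The level sets of levels above [s] exhaust the level set of [s], so that
    their measure is right-continuous in the level. *)
Lemma level_measure_rcont w (s : R) (t : \bar R) : measurable_fun pos w ->
  (forall s', s < s' -> (dist w s' <= t)%E) -> (dist w s <= t)%E.
Proof.
move=> mw h.
pose F n := [set x | 0 < r x /\ s + n.+1%:R^-1 < w x].
have FE : \bigcup_n F n = [set x | 0 < r x /\ s < w x].
  apply/seteqP; split => [x [n _ [x0 nx]]|x [x0 sx]].
    by split => //; apply: lt_trans nx; rewrite ltrDl invr_gt0.
  have [n nx] := ltr_add_invr sx.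
  by exists n.
have mF n : measurable (F n) by exact: measurable_level_set.
have : (mu \o F) x @[x --> \oo] --> mu (\bigcup_n F n).
  apply: nondecreasing_cvg_mu => //; first by exact: bigcupT_measurable.
  move=> n m nm; apply/subsetPset => x [x0 nx]; split => //.
  by apply: le_lt_trans nx; rewrite lerD2l lef_pV2 ?posrE// ler_nat.
rewrite FE => cvF; apply: (cvge_le _ cvF).
by apply: nearW => n; apply: h; rewrite ltrDl invr_gt0.
Qed.

Lemma rearr_ge0 w (t : R) : (0 <= rs w t)%E.
Proof. by apply: le_ereal_inf_tmp => _ [s [s0 _]] <-; rewrite lee_fin. Qed.

(** By right-continuity the infimum that defines the rearrangement is attained,
    which makes levels and measures of level sets adjoint. *)
Lemma rearr_leP w (t s : R) : measurable_fun pos w -> 0 <= s ->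
  (rs w t <= s%:E)%E = (dist w s <= t%:E)%E.
Proof.
move=> mw s0; apply/idP/idP => [h|h]; last by apply: ereal_inf_lbound; exists s.
apply: level_measure_rcont => // s' ss'.
have : (rs w t < s'%:E)%E by apply: le_lt_trans h _; rewrite lte_fin.
move/ereal_inf_lt => [_ [p [p0 pt] <-]]; rewrite lte_fin => /ltW ps'.
exact: le_trans (level_measure_nincr mw ps') pt.
Qed.

Lemma rearr_gtP w (t s : R) : measurable_fun pos w -> 0 <= s ->
  (s%:E < rs w t)%E = (t%:E < dist w s)%E.
Proof. by move=> mw s0; rewrite !ltNge rearr_leP. Qed.

Lemma rearr_nincr w (t t' : R) : t <= t' -> (rs w t' <= rs w t)%E.
Proof.
move=> tt'; apply: le_ereal_inf => _ [s [s0 st] <-]; exists s => //; split => //.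
by apply: le_trans st _; rewrite lee_fin.
Qed.

Lemma le_rearr_ae u w (t : R) :
  measurable_fun pos u -> measurable_fun pos w ->
  {ae mu, forall x, 0 < r x -> u x <= w x} -> (rs u t <= rs w t)%E.
Proof.
move=> mu_ mw uw; apply: le_ereal_inf => _ [s [s0 st] <-]; exists s => //.
by split => //; apply: le_trans st; exact: le_level_measure_ae.
Qed.

Lemma measurable_rearr w (D : set T) : D `<=` pos ->
  measurable_fun D (fun x => rs w (r x)).
Proof. by move=> Dp; apply: measurable_nincr => // x y _; exact: rearr_nincr. Qed.

(** Fubini for the indicator of the region under the graph of [b]. *)
Lemma layer_cake_setT (b : T -> R) : measurable_fun setT b ->
  (forall x, 0 <= b x) ->
  (\int[mu]_x (b x)%:E =
   \int[lebesgue_measure]_(s in `[0%R, +oo[) mu [set x | (s < b x)%R])%E.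
Proof.
move=> mb b0.
pose Z := [set p : T * measurableTypeR R | 0 <= p.2 /\ p.2 < b p.1].
have mZ : measurable Z.
  have -> : Z = snd @^-1` `[0, +oo[%classic `&`
      (fun p : T * measurableTypeR R => b p.1 - p.2) @^-1` `]0, +oo[%classic.
    by apply/seteqP; split => p/=; rewrite !in_itv/= !andbT subr_gt0.
  apply: measurableI.
    rewrite -[X in measurable X]setTI.
    by apply: (@measurable_snd _ _ T (measurableTypeR R)) => //.
  rewrite -[X in measurable X]setTI.
  have mf : measurable_fun setT (fun p : T * measurableTypeR R => b p.1 - p.2).
    apply: measurable_funB.
      exact: (measurableT_comp mb (@measurable_fst _ _ T (measurableTypeR R))).
    exact: (@measurable_snd _ _ T (measurableTypeR R)).
  exact: mf.
transitivity (\int[mu]_x \int[lebesgue_measure]_s (\1_Z (x, s))%:E)%E.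
  apply: eq_integral => x _.
  transitivity (\int[lebesgue_measure]_(s in setT) (\1_(`[0%R, b x[%classic : set R) s)%:E)%E.
    rewrite integral_indic// setIT.
    have lebE : lebesgue_measure `[0, b x[%classic = (b x)%:E.
      rewrite lebesgue_measure_itv/= lte_fin.
      have := b0 x; rewrite le_eqVlt => /predU1P[<-|->]; first by rewrite ltxx.
      by rewrite -EFinB subr0.
    exact/esym.
  apply: eq_integral => s _; rewrite !indicE; congr ((nat_of_bool _)%:R%:E).
  apply/idP/idP => [/set_mem/=|/set_mem/= [/= s0 sb]].
    by rewrite in_itv/= => /andP[s0 sb]; apply: mem_set.
  by apply: mem_set => /=; rewrite in_itv/= s0.
rewrite (fubini_tonelli (fun p : T * measurableTypeR R => (\1_Z p)%:E)).
- rewrite [RHS]integral_mkcond; apply: eq_integral => s _.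
  rewrite patchE; case: ifPn => [/set_mem/=|/negP sn].
    rewrite in_itv/= andbT => s0.
    rewrite -[X in mu X]setIT -integral_indic//; last first.
      have -> : [set x | s < b x] = b @^-1` `]s, +oo[%classic.
        by apply/seteqP; split => x /=; rewrite in_itv/= andbT.
      by rewrite -[X in measurable X]setTI; exact: mb.
    apply: eq_integral => x _; rewrite !indicE; congr ((nat_of_bool _)%:R%:E).
    by apply/idP/idP => [/set_mem/= [_ ?]|/set_mem/= ?]; apply: mem_set.
  apply: integral0_eq => x _; rewrite indicE memNset// => -[/= s0 _].
  by apply: sn; apply: mem_set => /=; rewrite in_itv/= s0.
- by apply/measurable_EFinP/measurable_indic.
- by move=> p; rewrite lee_fin.
Qed.

Lemma layer_cake (D : set T) (a : T -> R) : measurable D ->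
  measurable_fun D a -> (forall x, 0 <= a x) ->
  (\int[mu]_(x in D) (a x)%:E =
   \int[lebesgue_measure]_(s in `[0%R, +oo[) mu (D `&` [set x | (s < a x)%R]))%E.
Proof.
move=> mD ma a0.
transitivity (\int[mu]_x ((a \_ D) x)%:E)%E.
  rewrite integral_mkcond; apply: eq_integral => x _.
  by rewrite !patchE; case: ifP.
rewrite layer_cake_setT//; first last.
- by move=> x; rewrite patchE; case: ifP.
- by apply/(measurable_restrictT _ mD).
apply: eq_integral => s /set_mem/=; rewrite in_itv/= andbT => s0.
congr (mu _); apply/seteqP; split => x /=; rewrite patchE.
- by case: ifPn => [/set_mem|_] //; rewrite ltNge s0.
- by move=> [Dx sa]; rewrite mem_set.
Qed.

Definition tame w : Prop :=
  measurable_fun pos w /\ forall t, 0 < t -> (rs w t < +oo)%E.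

Lemma rearr_fineE w (t : R) : tame w -> 0 < t -> rs w t = (fine (rs w t))%:E.
Proof.
by move=> [_ h] t0; rewrite fineK// ge0_fin_numE ?rearr_ge0//; exact: h.
Qed.

(** By adjunction [s < w^*(x)] means that [x] is below the measure of the level
    set of [w], and the initial interval with that end has that measure. *)
Lemma level_measure_rearr w (s : R) : tame w -> 0 <= s ->
  dist (fun x => fine (rs w (r x))) s = dist w s.
Proof.
move=> tw s0; rewrite -[RHS]measure_lt_ereal//; congr (mu _).
apply/seteqP; split => x /= [x0 h]; split => //; move: h;
  by rewrite -lte_fin -rearr_fineE// rearr_gtP//; exact: tw.1.
Qed.

Lemma measurable_fine_rearr w : measurable_fun pos (fun x => fine (rs w (r x))).
Proof.
apply: (measurableT_comp (fine_measurable measurableT)).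
exact: measurable_rearr.
Qed.

Lemma measurable_excess w (l : R) (D : set T) : D `<=` pos ->
  measurable_fun pos w -> measurable_fun D (fun x => (Num.max (w x - l) 0)%:E).
Proof.
move=> Dp mw; apply: (measurable_funS measurable_half_line Dp).
apply/measurable_EFinP; apply: measurable_maxr => //.
by apply: measurable_funB => //; exact: measurable_cst.
Qed.

(** By the layer cake formula both integrals depend only on the measures of
    the level sets, and these agree by [level_measure_rearr]. *)
Lemma equimeasurable w (l : R) : tame w -> 0 <= l ->
  (\int[mu]_(x in pos) (Num.max (fine (rs w (r x)) - l) 0)%:E =
   \int[mu]_(x in pos) (Num.max (w x - l) 0)%:E)%E.
Proof.
move=> tw l0.
have h v : measurable_fun pos v ->
    (\int[mu]_(x in pos) (Num.max (v x - l) 0)%:E =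
     \int[lebesgue_measure]_(s in `[0%R, +oo[) dist v (s + l)%R)%E.
  move=> mv; rewrite layer_cake//; last first.
  - by move=> x; rewrite le_max lexx orbT.
  - by apply: measurable_maxr => //; exact: measurable_funB.
  apply: eq_integral => s /set_mem/=; rewrite in_itv/= andbT => s0.
  congr (mu _); apply/seteqP; split => x /=; rewrite half_lineE.
    by rewrite lt_max ltrBrDr [X in _ || X]ltNge s0 orbF => -[].
  by move=> [-> sv]; rewrite lt_max ltrBrDr sv.
rewrite (h _ (measurable_fine_rearr w)) (h _ tw.1).
apply: eq_integral => s /set_mem/=; rewrite in_itv/= andbT => s0.
by rewrite level_measure_rearr// addr_ge0.
Qed.

Definition rearr_integral w (t : R) : \bar R := (\int[mu]_(x in initial t) rs w (r x))%E.
Local Notation K := rearr_integral.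

Lemma rearr_integral_ge0 w (t : R) : (0 <= K w t)%E.
Proof. by apply: integral_ge0 => x _; exact: rearr_ge0. Qed.

Lemma integral_cst_initial (c t : R) : 0 <= t ->
  (\int[mu]_(x in initial t) c%:E = (c * t)%:E)%E.
Proof.
move=> t0; rewrite (integral_cst mu (measurable_initial t) c%:E).
by rewrite EFinM -(mu_r t0).
Qed.

Lemma rearr_integral_le_excess w (t l : R) : tame w -> 0 <= l -> 0 < t ->
  (K w t <= (l * t)%:E + \int[mu]_(x in pos) (Num.max (w x - l) 0)%:E)%E.
Proof.
move=> tw l0 t0; rewrite -(integral_cst_initial _ (ltW t0)) -equimeasurable//.
have mm D : D `<=` pos -> measurable_fun D
    (fun x => (Num.max (fine (rs w (r x)) - l) 0)%:E).
  by move=> Dp; apply: measurable_excess => //; exact: measurable_fine_rearr.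
apply: (@le_trans _ _ (\int[mu]_(x in initial t) (l%:E +
   (Num.max (fine (rs w (r x)) - l)%R 0%R)%:E))%E).
  apply: ge0_le_integral => //.
  - by move=> x _; exact: rearr_ge0.
  - by apply: measurable_rearr => //; exact: initial_half_line.
  - by apply: emeasurable_funD => //; apply: mm; exact: initial_half_line.
  - move=> x; rewrite initialE => /andP[x0 _]; rewrite rearr_fineE// -EFinD lee_fin.
    by rewrite -lerBlDl le_max lexx.
rewrite ge0_integralD//.
- rewrite leeD2l//; apply: ge0_subset_integral => //; last exact: initial_half_line.
    exact: mm.
  by move=> x _; rewrite lee_fin le_max lexx orbT.
- by move=> x _; rewrite lee_fin le_max lexx orbT.
- by apply: mm; exact: initial_half_line.
Qed.

Lemma rearr_integral_excessE w (t : R) : tame w -> 0 < t ->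
  (K w t = (fine (rs w t) * t)%:E +
    \int[mu]_(x in pos) (Num.max (w x - fine (rs w t)) 0)%:E)%E.
Proof.
move=> tw t0; set l := fine (rs w t).
have l0 : 0 <= l by rewrite fine_ge0// rearr_ge0.
apply/le_anti/andP; split; first exact: rearr_integral_le_excess.
rewrite -(integral_cst_initial _ (ltW t0)) -equimeasurable//.
have mm D : D `<=` pos -> measurable_fun D
    (fun x => (Num.max (fine (rs w (r x)) - l) 0)%:E).
  by move=> Dp; apply: measurable_excess => //; exact: measurable_fine_rearr.
have -> : (\int[mu]_(x in pos) (Num.max (fine (rs w (r x)) - l) 0)%:E =
   \int[mu]_(x in initial t) (Num.max (fine (rs w (r x)) - l)%R 0%R)%:E)%E.
  rewrite integral_mkcond [RHS]integral_mkcond; apply: eq_integral => x _.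
  rewrite !patchE.
  have [x0|x0] := ltP 0 (r x); last first.
    by rewrite !memNset// ?half_lineE ?initialE ltNge x0.
  rewrite mem_set/=; last by rewrite half_lineE.
  have [xt|xt] := ltP (r x) t; first by rewrite mem_set// initialE x0.
  rewrite memNset//; last by rewrite initialE x0 ltNge xt.
  congr (_%:E); apply/max_idPr; rewrite subr_le0 -lee_fin -!rearr_fineE//.
  exact: rearr_nincr.
rewrite -ge0_integralD//.
- apply: ge0_le_integral => //.
  + by move=> x _; rewrite -EFinD lee_fin addr_ge0// le_max lexx orbT.
  + by apply: emeasurable_funD => //; apply: mm; exact: initial_half_line.
  + by apply: measurable_rearr => //; exact: initial_half_line.
  + move=> x; rewrite initialE => /andP[x0 xt].
    have lx : l <= fine (rs w (r x)) by rewrite -lee_fin -!rearr_fineE// rearr_nincr// ltW.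
    by rewrite [leRHS]rearr_fineE// -EFinD lee_fin max_l ?subr_ge0// addrCA subrr addr0.
- by move=> x _; rewrite lee_fin le_max lexx orbT.
- by apply: mm; exact: initial_half_line.
Qed.

Lemma tame_level w (t : R) : tame w -> 0 < t ->
  exists2 s, 0 <= s & (dist w s <= t%:E)%E.
Proof.
move=> tw t0; exists (fine (rs w t)); first by rewrite fine_ge0 ?rearr_ge0.
by rewrite -rearr_leP ?fine_ge0 ?rearr_ge0//; [rewrite -rearr_fineE|exact: tw.1].
Qed.

Lemma tameD u v : tame u -> tame v -> tame (fun x => u x + v x).
Proof.
move=> tu tv; have mu_ := tu.1; have mv := tv.1.
have muv : measurable_fun pos (fun x => u x + v x) by exact: measurable_funD.
split => // t t0.
have t2 : 0 < t / 2 by rewrite divr_gt0.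
have [a a0 ua] := tame_level tu t2; have [b b0 vb] := tame_level tv t2.
apply: (@le_lt_trans _ _ (a + b)%:E); last exact: ltry.
rewrite rearr_leP ?addr_ge0// (splitr t) EFinD.
apply: (@le_trans _ _ (dist u a + dist v b)%E); last exact: leeD.
apply: le_trans (measureU2 mu (measurable_level_set a mu_) (measurable_level_set b mv)).
apply: le_measure; rewrite ?inE.
- exact: measurable_level_set.
- by apply: measurableU; exact: measurable_level_set.
- move=> x [x0 abx]; have [ax|ax] := ltP a (u x); first by left.
  have [bx|bx] := ltP b (v x); first by right.
  by move: abx; rewrite ltNge lerD.
Qed.

(** [K w t] is the minimum over [l >= 0] of [l * t + \int (w - l)^+], attained
    at [l = w^*(t)]; the excess [(w - l)^+] is jointly subadditive in [w] and
    [l]. *)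
Lemma rearr_integralD u v (t : R) : tame u -> tame v -> 0 < t ->
  (K (fun x => u x + v x)%R t <= K u t + K v t)%E.
Proof.
move=> tu tv t0; rewrite (rearr_integral_excessE tu t0) (rearr_integral_excessE tv t0).
set a := fine (rs u t); set b := fine (rs v t).
have a0 : 0 <= a by rewrite fine_ge0 ?rearr_ge0.
have b0 : 0 <= b by rewrite fine_ge0 ?rearr_ge0.
apply: le_trans (rearr_integral_le_excess (tameD tu tv) (addr_ge0 a0 b0) t0) _.
rewrite addeACA -EFinD -mulrDl leeD2l//.
have mm w c : measurable_fun pos w ->
    measurable_fun pos (fun x => (Num.max (w x - c) 0)%:E).
  exact: measurable_excess.
have mu_ := mm _ a tu.1; have mv := mm _ b tv.1.
rewrite -ge0_integralD//; try by move=> x _; rewrite lee_fin le_max lexx orbT.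
apply: ge0_le_integral => //.
- by move=> x _; rewrite lee_fin le_max lexx orbT.
- exact: (mm _ (a + b) (tameD tu tv).1).
- exact: emeasurable_funD.
- move=> x _; rewrite -EFinD lee_fin ge_max; apply/andP; split.
    by rewrite opprD addrACA lerD// le_max lexx.
  by rewrite addr_ge0// le_max lexx orbT.
Qed.

End rearrangement.

(** * Staircases and the tangent line of the logarithm *)

Section staircase.
Variable R : realType.
Implicit Types a b e w : R.

(** For [0 <= a <= n * e], an approximation of [a] from below within [e] by a
    sum of level indicators: the integral of a function against it
    splits into integrals over level sets. *)
Fixpoint staircase e a n : R :=
  if n is m.+1 then staircase e a m + (if n%:R * e < a then e else 0) else 0.

Lemma staircase_le e a n : 0 <= e -> 0 <= a ->
  Num.min a (n.+1%:R * e) - e <= staircase e a n <= Num.min a (n%:R * e).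
Proof.
move=> e0 a0; elim: n => [|n /andP[IH1 IH2]].
  by rewrite mul1r mul0r /= !minEle; case: ifP => h1; case: ifP => h2; lra.
move: IH1 IH2; rewrite /= -[n.+2%:R]natr1 -[n.+1%:R]natr1 !mulrDl !mul1r.
set s := staircase _ _ _; set p := n%:R * e.
move=> IH1 IH2; apply/andP; split; move: IH1 IH2.
  by rewrite !minEle; do ?case: ifPn; rewrite -?ltNge -?leNgt; lra.
by rewrite !minEle; do ?case: ifPn; rewrite -?ltNge -?leNgt; lra.
Qed.

Lemma staircase_mono e n a b : 0 <= e -> a <= b ->
  staircase e a n <= staircase e b n.
Proof.
move=> e0 ab; elim: n => //= n IH; rewrite lerD//.
by case: ifP => [/lt_le_trans -> //|_]; case: ifP.
Qed.

Lemma staircase_eq0 e n a : 0 <= e -> a <= e -> staircase e a n = 0.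
Proof.
move=> e0 ae; elim: n => //= n ->; rewrite add0r ltNge.
by rewrite (le_trans ae)// ler_peMl// ler1n.
Qed.

(** The exponential is above its tangent line at [ln w], and [ln w <= ln a]. *)
Lemma log_tangent a b w : 0 <= w -> w <= a -> 0 < a -> 0 < b ->
  w + w * (ln b - ln a) <= b.
Proof.
rewrite le_eqVlt => /predU1P[<-|w0] wa a0 b0; first by rewrite mul0r addr0 ltW.
have bw : 0 < b / w by rewrite divr_gt0.
have h1 : ln b - ln w <= b / w - 1.
  rewrite -ln_div ?posrE//; have := @le_ln1Dx R (b / w - 1).
  by rewrite addrCA subrr addr0; apply; rewrite ltrBrDl subrr.
have h2 : ln w <= ln a by rewrite ler_ln ?posrE.
have h3 : w * (ln b - ln a) <= w * (b / w - 1).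
  by apply: ler_wpM2l; [exact: ltW | apply: le_trans h1; rewrite lerD2l lerN2].
have h4 : w * (b / w - 1) = b - w.
  by rewrite mulrBr mulrCA divff ?gt_eqF// !mulr1.
by move: h3; rewrite h4; lra.
Qed.

End staircase.

Lemma integrable_of_pos_part d (T : measurableType d) (R : realType)
    (mu : {measure set T -> \bar R}) (D : set T) (f : T -> \bar R) :
  measurable D -> measurable_fun D f ->
  (\int[mu]_(x in D) (f^\+ x) < +oo)%E -> (-oo < \int[mu]_(x in D) f x)%E ->
  mu.-integrable D f.
Proof.
move=> mD mf fpos fgt; apply/integrableP; split => //.
have -> : (\int[mu]_(x in D) `|f x| =
    \int[mu]_(x in D) f^\+ x + \int[mu]_(x in D) f^\- x)%E.
  rewrite -ge0_integralD//; first by apply: eq_integral => x _; rewrite -/((abse \o f) x) fune_abse.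
  - exact: measurable_funepos.
  - exact: measurable_funeneg.
rewrite lte_add_pinfty//.
move: fgt; rewrite integralE.
have : (0 <= \int[mu]_(x in D) f^\+ x)%E by exact: integral_ge0.
have : (0 <= \int[mu]_(x in D) f^\- x)%E by exact: integral_ge0.
move: fpos; case: integral => [p| |]//; case: integral => [q| |]//.
by move=> *; rewrite ltry.
Qed.

(** * Weyl inequality: logarithmic submajorization implies submajorization *)

Section weyl.
Variables (d : measure_display) (T : measurableType d) (R : realType).
Variables (mu : {sigma_finite_measure set T -> \bar R}) (r : T -> R).
Hypothesis mr : measurable_fun setT r.
Hypothesis mu_r : forall t : R, 0 <= t -> mu (r @^-1` `]0, t[) = t%:E.
Local Notation pos := (half_line r).
Local Notation ini := (initial r).
Local Hint Extern 0 (measurable (initial _ _)) => exact: measurable_initial : core.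

Variables (A B : R -> R) (M : R).
Hypothesis M0 : 0 < M.
Hypothesis A0 : forall x, 0 < x -> 0 <= A x.
Hypothesis B0 : forall x, 0 < x -> 0 <= B x.
Hypothesis A_nincr : forall x y, 0 < x -> x <= y -> A y <= A x.
Hypothesis B_nincr : forall x y, 0 < x -> x <= y -> B y <= B x.
Hypothesis BM : forall x, 0 < x -> B x <= M.
(* Satisfied by rearrangements: they are right-continuous. *)
Hypothesis levelA : forall s t, 0 <= s -> 0 < t -> exists2 c, 0 <= c <= t &
  forall y, 0 < y < t -> (s < A y) = (y < c).
Hypothesis iA : forall t, 0 < t ->
  mu.-integrable (ini t) (fun x => log_plus (A (r x))%:E).
Hypothesis AB : forall t, 0 < t ->
  (\int[mu]_(x in ini t) lne (A (r x))%:E <=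
   \int[mu]_(x in ini t) lne (B (r x))%:E)%E.

Let mI (t : R) : measurable (ini t). Proof. exact: measurable_initial. Qed.

Lemma measurable_comp_nincr (f : R -> R) (t : R) :
  (forall x y, 0 < x -> x <= y -> f y <= f x) ->
  measurable_fun (ini t) (f \o r).
Proof.
move=> f_ni; apply/measurable_EFinP.
apply: (measurable_nincr mr (f := EFin \o f)); first exact: initial_half_line.
by move=> x y x0 xy; rewrite lee_fin f_ni.
Qed.

Lemma measure_initial_fin (t : R) : (mu (ini t) < +oo)%E.
Proof.
have [t0|t0] := leP 0 t; first by rewrite /initial mu_r// ltry.
have -> : ini t = set0.
  by apply/seteqP; split => x //; rewrite initialE => /andP[/lt_trans h /h]; rewrite ltNge ltW.
by rewrite measure0.
Qed.

Lemma integrable_bounded_initial (f : T -> R) (k t : R) :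
  measurable_fun (ini t) f -> (forall x, ini t x -> `|f x| <= k) ->
  mu.-integrable (ini t) (EFin \o f).
Proof.
move=> mf fk; apply: measurable_bounded_integrable => //.
  exact: measure_initial_fin.
by exists k; split; [exact: num_real|move=> z kz x /fk /le_trans; apply; exact: ltW].
Qed.

Lemma integrable_cst_initial (k t : R) : mu.-integrable (ini t) (fun=> k%:E).
Proof.
by apply: (@integrable_bounded_initial (fun=> k) `|k|).
Qed.

Lemma integrable_lnA (c e : R) : 0 < e -> 0 < c ->
  (forall y, 0 < y < c -> e < A y) ->
  mu.-integrable (ini c) (fun x => (ln (A (r x)))%:E).
Proof.
move=> e0 c0 eA.
have iC : mu.-integrable (ini c) (fun=> `|ln e|%:E).
  exact: integrable_cst_initial.
apply: (le_integrable (mI c) _ _ (integrableD (mI c) (iA c0) iC)).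
  apply/measurable_EFinP; apply: (measurableT_comp (@measurable_ln R)).
  exact: measurable_comp_nincr.
move=> x; rewrite initialE => xc; have eAx := eA _ xc.
have Ax0 : 0 < A (r x) by exact: lt_trans eAx.
rewrite /= /log_plus lne_EFin// -EFin_max -EFinD lee_fin.
rewrite [leRHS]ger0_norm; last by rewrite addr_ge0// le_max lexx orbT.
have : ln e <= ln (A (r x)) by rewrite ler_ln ?posrE// ltW.
have := ler_norm (- ln e); rewrite normrN; have := normr_ge0 (ln e).
rewrite ler_norml maxEle; case: ifPn; rewrite -?ltNge => *; apply/andP; split; lra.
Qed.

(** The integral of [ln B] is bounded below by that of [ln A] and above through
    [B <= M]; a decreasing [B] vanishing before [c] would make it infinite. *)
Lemma integrable_lnB (c : R) : 0 < c -> (forall y, 0 < y < c -> 0 < A y) ->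
  mu.-integrable (ini c) (fun x => (ln (A (r x)))%:E) ->
  (forall y, 0 < y < c -> 0 < B y) /\
  mu.-integrable (ini c) (fun x => (ln (B (r x)))%:E).
Proof.
move=> c0 Apos ilnA.
have ilB : mu.-integrable (ini c) (fun x => lne (B (r x))%:E).
  apply: integrable_of_pos_part => //.
  - apply: (measurable_nincr mr (f := fun y => lne (B y)%:E)); first exact: initial_half_line.
    move=> x y x0 xy; rewrite lee_lne ?in_itv/= ?lee_fin ?leey ?andbT ?B0//.
    + exact: B_nincr.
    + exact: lt_le_trans xy.
  - apply: (@le_lt_trans _ _ (\int[mu]_(x in ini c) `|ln M|%:E)%E); last first.
      by rewrite (integral_cst_initial mr mu_r)// ?ltry// ltW.
    apply: ge0_le_integral => //.
    + apply: measurable_funepos.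
      apply: (measurable_nincr mr (f := fun y => lne (B y)%:E)); first exact: initial_half_line.
      move=> x y x0 xy; rewrite lee_lne ?in_itv/= ?lee_fin ?leey ?andbT ?B0//.
      * exact: B_nincr.
      * exact: lt_le_trans xy.
    + move=> x; rewrite initialE => /andP[x0 _]; rewrite funeposE /= .
      case: ifPn => [_|]; first by rewrite maxNye lee_fin.
      rewrite -ltNge => Bx0; rewrite -EFin_max lee_fin ge_max normr_ge0 andbT.
      by apply: le_trans (ler_norm _); rewrite ler_ln ?posrE// BM.
  - apply: lt_le_trans (AB c0).
    rewrite (_ : integral _ _ _ = (\int[mu]_(x in ini c) (ln (A (r x)))%:E)%E).
      by have /integrable_fin_num := ilnA; rewrite fin_numE => /(_ (mI c))/andP[]; rewrite ltNye.
    apply: eq_integral => x /set_mem; rewrite initialE => xc /=.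
    by rewrite leNgt Apos.
have Bpos y : 0 < y < c -> 0 < B y.
  move=> /andP[y0 yc]; rewrite ltNge; apply/negP => By.
  have [N [mN N0 hN]] := integrable_ae (mI c) ilB.
  have : (mu (ini c) <= mu (ini y `|` N))%E.
    apply: le_measure; rewrite ?inE//; first exact: measurableU.
    move=> x; rewrite initialE => xc; have [ry|yr] := ltP (r x) y.
      by left; rewrite initialE ry; case/andP: xc => ->.
    right; apply: hN => /=; rewrite initialE => /(_ xc) /=.
    by rewrite (le_trans (B_nincr y0 yr)).
  move=> /le_trans /(_ (measureU2 mu (mI y) mN)).
  rewrite [X in (_ + X)%E]N0 adde0 /initial.
  by rewrite (mu_r (ltW c0)) [leRHS](mu_r (ltW y0)) lee_fin leNgt yc.
split => //; apply: eq_integrable ilB => // x /set_mem; rewrite initialE => xc.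
by rewrite lne_EFin// Bpos.
Qed.

(** The mean of [ln A] over [(0, x)] is at least [ln (A x)], that of [ln B] at
    most [ln M]. *)
Lemma weyl_bounded (x : R) : 0 < x -> A x <= M.
Proof.
move=> x0; have [Ax|Ax] := leP (A x) 0; first exact: le_trans Ax (ltW M0).
have eA y : 0 < y < x -> A x / 2 < A y.
  move=> /andP[y0 yx]; apply: lt_le_trans (A_nincr y0 (ltW yx)).
  by rewrite ltr_pdivrMr// mulr_natr mulr2n ltrDl.
have A2 : 0 < A x / 2 by rewrite divr_gt0.
have iLA := integrable_lnA A2 x0 eA.
have Apos y : 0 < y < x -> 0 < A y by move=> /eA; exact: lt_trans.
have [Bpos iLB] := integrable_lnB x0 Apos iLA.
rewrite -ler_ln ?posrE// -(ler_pM2r x0) -lee_fin.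
rewrite -!(integral_cst_initial mr mu_r _ (ltW x0)).
have iC (k : R) : mu.-integrable (ini x) (fun=> k%:E).
  exact: integrable_cst_initial.
apply: (@le_trans _ _ (\int[mu]_(y in ini x) (ln (A (r y)))%:E)%E).
  apply: le_integral => // y /set_mem; rewrite initialE => yx.
  rewrite lee_fin ler_ln ?posrE//; last exact: Apos.
  by case/andP: yx => y0 /ltW; exact: A_nincr.
apply: (@le_trans _ _ (\int[mu]_(y in ini x) (ln (B (r y)))%:E)%E).
  have := AB x0; congr (_ <= _)%E; apply: eq_integral => y /set_mem.
    by rewrite initialE => yx; rewrite lne_EFin// Apos.
  by rewrite initialE => yx; rewrite lne_EFin// Bpos.
apply: le_integral => // y /set_mem; rewrite initialE => yx.
rewrite lee_fin ler_ln ?posrE//; last exact: Bpos.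
by apply: BM; case/andP: yx.
Qed.

(** [staircase e] turns [A] into a combination of indicators of initial
    intervals, on each of which the integral of [ln B - ln A] is
    nonnegative. *)
Lemma staircase_integral (c e : R) (n : nat) : 0 < c -> 0 < e ->
  (forall y, 0 < y < c -> 0 < A y) -> (forall y, 0 < y < c -> 0 < B y) ->
  mu.-integrable (ini c) (fun x => (ln (A (r x)))%:E) ->
  mu.-integrable (ini c) (fun x => (ln (B (r x)))%:E) ->
  let h x := staircase e (A (r x)) n * (ln (B (r x)) - ln (A (r x))) in
  mu.-integrable (ini c) (EFin \o h) /\
  (0 <= \int[mu]_(x in ini c) (h x)%:E)%E.
Proof.
move=> c0 e0 Apos Bpos iLA iLB.
pose g x := ln (B (r x)) - ln (A (r x)).
have ig : mu.-integrable (ini c) (EFin \o g).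
  by have := integrableB (mI c) iLB iLA; apply: eq_integrable.
elim: n => [|n [IH1 IH2]] h.
  have h0 x : h x = 0 by rewrite /h mul0r.
  split; last by apply: integral_ge0 => x _; rewrite h0.
  by apply: eq_integrable (integrable0 _ _) => // x _; rewrite /= h0.
have ne0 : 0 <= n.+1%:R * e by rewrite mulr_ge0// ltW.
have [c' /andP[c'0 c'c] lev] := levelA ne0 c0.
pose k x := (if n.+1%:R * e < A (r x) then e else 0) * g x.
have kE x : ini c x -> (k x)%:E = (e%:E * ((EFin \o g) \_ (ini c')) x)%E.
  rewrite initialE => xc; rewrite /k lev// patchE.
  have -> : (x \in ini c') = (r x < c').
    apply/idP/idP => [/set_mem|rc']; first by rewrite initialE => /andP[].
    by apply/mem_set; rewrite initialE rc'; case/andP: xc => ->.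
  by case: ifP => _; rewrite /= ?mul0r ?mule0// -EFinM.
have ic' : mu.-integrable (ini c) ((EFin \o g) \_ (ini c')).
  apply: (integrableS measurableT (mI c) (@subsetT _ _)).
  apply/(integrable_mkcond _ (mI c')).
  by apply: (integrableS (mI c) (mI c') _ ig); exact: initialS.
have ik : mu.-integrable (ini c) (EFin \o k).
  by apply: eq_integrable (integrableZl (mI c) e ic') => // x /set_mem xc; rewrite /= kE.
have hE x : h x = staircase e (A (r x)) n * g x + k x by rewrite /h/= mulrDl.
split.
  by apply: eq_integrable (integrableD (mI c) IH1 ik) => // x _; rewrite /= hE.
rewrite (_ : integral _ _ _ = \int[mu]_(x in ini c)
   ((staircase e (A (r x)) n * g x)%:E + (k x)%:E))%E; last first.
  by apply: eq_integral => x _; rewrite hE.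
rewrite integralD// adde_ge0//.
rewrite (_ : integral _ _ _ = \int[mu]_(x in ini c)
  (e%:E * ((EFin \o g) \_ (ini c')) x))%E; last first.
  by apply: eq_integral => x /set_mem xc; rewrite kE.
rewrite integralZl// mule_ge0 ?lee_fin ?(ltW e0)//.
rewrite -integral_mkcondr setIidr; last exact: initialS.
have [c'_0|c'_0] := leP c' 0.
  rewrite (_ : ini c' = set0) ?integral_set0//.
  apply/seteqP; split => x //; rewrite initialE => /andP[x0 /(lt_trans x0)].
  by rewrite ltNge c'_0.
have xc' x : ini c' x -> 0 < r x < c.
  by rewrite initialE => /andP[-> /lt_le_trans]; apply.
rewrite (_ : integral _ _ _ = \int[mu]_(x in ini c')
   ((ln (B (r x)))%:E - (ln (A (r x)))%:E))%E//.
rewrite integralB//.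
- rewrite sube_ge0; last first.
    apply/orP; left; apply: integrable_fin_num => //.
    by apply: integrableS iLA => //; exact: initialS.
  have := AB c'_0; congr (_ <= _)%E; apply: eq_integral => y /set_mem /xc' yx.
    by rewrite lne_EFin// Apos.
  by rewrite lne_EFin// Bpos.
- by apply: integrableS iLB => //; exact: initialS.
- by apply: integrableS iLA => //; exact: initialS.
Qed.

(** The tangent inequality with [w] the staircase below [A], integrated, gives
    [\int w <= \int B], because the term with the logarithms is nonnegative by
    [staircase_integral]; and [A <= w + e]. *)
Lemma weyl (t : R) : 0 < t ->
  (\int[mu]_(x in ini t) (A (r x))%:E <=
   \int[mu]_(x in ini t) (B (r x))%:E)%E.
Proof.
move=> t0; apply/lee_addgt0Pr => e' e'0.
pose e := e' / t; have e0 : 0 < e by rewrite divr_gt0.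
have [n Mn] : exists n, M <= n%:R * e.
  exists (Num.truncn (M / e)).+1; rewrite -ler_pdivrMr//.
  exact/ltW/truncnS_gt.
have [c /andP[c0 ct] lev] := levelA (ltW e0) t0.
pose w x := staircase e (A (r x)) n.
have wP x : 0 < r x -> [/\ A (r x) <= w x + e, 0 <= w x & w x <= A (r x)].
  move=> x0; have Ax0 := A0 x0.
  have /andP[] := staircase_le n (ltW e0) Ax0.
  have AM : A (r x) <= n%:R * e by apply: le_trans Mn; exact: weyl_bounded.
  have w00 : 0 <= w x.
    apply: le_trans (staircase_mono n (ltW e0) Ax0).
    by elim: (n) => //= m IH; rewrite addr_ge0//; case: ifP => // _; exact: ltW.
  rewrite (min_idPl _); last by apply: le_trans AM _; apply: ler_wpM2r; [exact: ltW|rewrite ler_nat].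
  rewrite (min_idPl _)// => *; split => //; rewrite /w; lra.
have mB (s : R) : measurable_fun (ini s) (EFin \o (B \o r)).
  by apply/measurable_EFinP; exact: measurable_comp_nincr.
have mw (s : R) : measurable_fun (ini s) w.
  apply: (@measurable_comp_nincr (fun y => staircase e (A y) n)) => x y x0 xy.
  by apply: staircase_mono; [exact: ltW|exact: A_nincr].
have wB : (\int[mu]_(x in ini t) (w x)%:E <= \int[mu]_(x in ini t) (B (r x))%:E)%E.
  rewrite (_ : integral _ _ _ =
      \int[mu]_(x in ini t) ((EFin \o w) \_ (ini c)) x)%E; last first.
    apply: eq_integral => x /set_mem; rewrite initialE => xt; rewrite patchE.
    case: ifPn => // /negP xc; rewrite /w staircase_eq0 ?(ltW e0)//.
    rewrite leNgt lev//; apply/negP => xc'; apply/xc/mem_set.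
    by rewrite initialE xc'; case/andP: xt => ->.
  rewrite -integral_mkcondr setIidr; last exact: initialS.
  have [c_0|c_0] := leP c 0.
    rewrite (_ : ini c = set0) ?integral_set0.
      by apply: integral_ge0 => x; rewrite initialE => /andP[x0 _]; rewrite lee_fin B0.
    apply/seteqP; split => x //; rewrite initialE => /andP[x0 /(lt_trans x0)].
    by rewrite ltNge c_0.
  have eA y : 0 < y < c -> e < A y.
    by move=> /andP[y0 yc]; rewrite lev// y0 (lt_le_trans yc).
  have Apos y : 0 < y < c -> 0 < A y by move=> /eA; exact: lt_trans.
  have iLA := integrable_lnA e0 c_0 eA.
  have [Bpos iLB] := integrable_lnB c_0 Apos iLA.
  have [/= ih h0] := staircase_integral n c_0 e0 Apos Bpos iLA iLB.
  have iw : mu.-integrable (ini c) (EFin \o w).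
    apply: (@integrable_bounded_initial _ M) => // x; rewrite initialE => /andP[x0 _].
    have [_ w0 wA] := wP _ x0; rewrite ger0_norm//.
    by apply: le_trans wA _; exact: weyl_bounded.
  apply: (@le_trans _ _ (\int[mu]_(x in ini c) (B (r x))%:E)%E); last first.
    apply: (ge0_subset_integral mu (mI c) (mI t) (mB t)); last exact: initialS.
    by move=> x; rewrite initialE => /andP[x0 _]; rewrite lee_fin B0.
  apply: le_trans (leeDl _ h0) _; rewrite -integralD//.
  apply: le_integral => //.
  - exact: integrableD.
  - apply: (@integrable_bounded_initial (B \o r) M); first exact: measurable_comp_nincr.
    move=> x; rewrite initialE => /andP[x0 _] /=; rewrite ger0_norm ?B0//.
    exact: BM.
  - move=> x /set_mem; rewrite initialE => xc; rewrite /= -EFinD lee_fin.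
    have /andP[x0 _] := xc; have [_ w0 wA] := wP _ x0.
    by apply: log_tangent => //; [exact: Apos|exact: Bpos].
apply: le_trans (leeD2r _ wB).
rewrite (_ : e' = e * t); last by rewrite /e divfK// gt_eqF.
rewrite -(integral_cst_initial mr mu_r _ (ltW t0)) -ge0_integralD//.
- apply: ge0_le_integral => //.
  + by move=> x; rewrite initialE => /andP[x0 _]; rewrite lee_fin A0.
  + by apply/measurable_EFinP; exact: measurable_comp_nincr.
  + by apply: emeasurable_funD => //; apply/measurable_EFinP; exact: mw.
  + move=> x; rewrite initialE => /andP[x0 _]; rewrite -EFinD lee_fin.
    by have [] := wP _ x0.
- by move=> x; rewrite initialE => /andP[x0 _]; rewrite lee_fin; have [] := wP _ x0.
- by apply/measurable_EFinP; exact: mw.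
- by move=> x _; rewrite lee_fin ltW.
Qed.
End weyl.

(** * Rearrangements under scaling, square roots and a.e. bounds *)

Lemma integralZl_pos_part d (T : measurableType d) (R : realType)
    (mu : {measure set T -> \bar R}) (D : set T) (f : T -> \bar R) (k : R) :
  measurable D -> measurable_fun D f -> 0 <= k ->
  (\int[mu]_(x in D) (f^\+ x) < +oo)%E ->
  (\int[mu]_(x in D) (k%:E * f x) = k%:E * \int[mu]_(x in D) f x)%E.
Proof.
move=> mD mf k0 fpos.
rewrite (integralE mu D f) (integralE mu D (fun x => k%:E * f x)%E).
rewrite (ge0_funeposM _ k0) (ge0_funenegM _ k0).
rewrite !ge0_integralZl//.
- rewrite [RHS]muleBr//; apply: fin_num_adde_defr.
  by rewrite ge0_fin_numE//; exact: integral_ge0.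
- exact: measurable_funeneg.
- exact: measurable_funepos.
Qed.

Section sqrt_lemmas.
Variable R : realType.

Lemma sqrt_le_amgm (e a : R) : 0 < e -> 0 <= a ->
  Num.sqrt a <= (2 * e)^-1 * a + e / 2.
Proof.
move=> e0 a0; rewrite -{2}(sqr_sqrtr a0); set s := Num.sqrt a.
rewrite -subr_ge0 (_ : _ - s = (s - e) ^+ 2 / (2 * e)).
  by rewrite divr_ge0 ?sqr_ge0// mulr_ge0// ltW.
by field; rewrite gt_eqF.
Qed.

Lemma sqrt_ltP (a s : R) : 0 <= s -> (s < Num.sqrt a) = (s ^+ 2 < a).
Proof.
move=> s0; have [a0|a0] := leP a 0.
  by rewrite ler0_sqrtr// ltNge s0 ltNge (le_trans a0)// sqr_ge0.
by rewrite -[in LHS](ger0_norm s0) -sqrtr_sqr ltr_sqrt.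
Qed.

Lemma lne_sqrt (a : R) :
  lne (Num.sqrt a)%:E = ((2^-1)%:E * lne a%:E)%E.
Proof.
have [a0|a0] := leP a 0.
  by rewrite ler0_sqrtr// !le0_lneNy// gt0_muleNy// lte_fin invr_gt0.
rewrite !lne_EFin ?sqrtr_gt0//.
by rewrite -powR12_sqrt ?ltW// ln_powR EFinM.
Qed.

Lemma measurable_sqrt : measurable_fun setT (@Num.sqrt R).
Proof. by apply: continuous_measurable_fun; exact: sqrt_continuous. Qed.

End sqrt_lemmas.

Section rearrangement_calculus.
Variables (d : measure_display) (T : measurableType d) (R : realType).
Variables (mu : {sigma_finite_measure set T -> \bar R}) (r : T -> R).
Hypothesis mr : measurable_fun setT r.
Hypothesis mu_r : forall t : R, 0 <= t -> mu (r @^-1` `]0, t[) = t%:E.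
Local Notation pos := (half_line r).
Local Notation ini := (initial r).
Local Notation dist := (level_measure mu r).
Local Notation rs := (rearrangement mu r).
Local Notation tame := (tame mu r).
Local Notation K := (rearr_integral mu r).
Local Hint Extern 0 (measurable (initial _ _)) => exact: measurable_initial : core.
Local Hint Extern 0 (measurable (half_line _)) => exact: measurable_half_line : core.
Implicit Types u v w : T -> R.

Let rearr_ge0' w (t : R) : (0 <= rs w t)%E.
Proof. exact: rearr_ge0. Qed.
Local Hint Resolve rearr_ge0' : core.

Lemma measurable_rearr_initial w (t : R) : measurable_fun (ini t) (fun x => rs w (r x)).
Proof. by apply: measurable_rearr => //; exact: initial_half_line. Qed.
Local Hint Extern 0 (measurable_fun _ (fun=> rearrangement _ _ _ _)) =>
  exact: measurable_rearr_initial : core.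

Lemma le_rearr u w (t : R) : (forall x, 0 < r x -> u x <= w x) ->
  measurable_fun pos u -> measurable_fun pos w -> (rs u t <= rs w t)%E.
Proof. by move=> uw mu_ mw; apply: le_rearr_ae => //; exact: aeW. Qed.

Lemma tame_le u w : (forall t, 0 < t -> (rs u t <= rs w t)%E) ->
  measurable_fun pos u -> tame w -> tame u.
Proof. by move=> uw mu_ tw; split => // t t0; exact: le_lt_trans (uw _ t0) (tw.2 _ t0). Qed.

Lemma le_rearr_integral u w (t : R) : (forall s, 0 < s -> (rs u s <= rs w s)%E) ->
  (K u t <= K w t)%E.
Proof.
move=> uw; apply: ge0_le_integral => //.
- by move=> x; rewrite initialE => /andP[x0 _]; exact: uw.
Qed.

Lemma rearr_scale_le w (c t : R) : tame w -> 0 <= c -> 0 < t ->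
  (rs (fun x => (c * w x)%R) t <= c%:E * rs w t)%E.
Proof.
move=> tw c0 t0; rewrite (rearr_fineE tw t0); set l := fine _.
have l0 : 0 <= l by rewrite fine_ge0 ?rearr_ge0.
have mcw : measurable_fun pos (fun x => c * w x) by exact: measurable_funM tw.1.
rewrite -EFinM rearr_leP//; last exact: mulr_ge0.
apply: (@le_trans _ _ (dist w l)); last by have mw := tw.1; rewrite -rearr_leP// /l -rearr_fineE.
apply: le_measure; rewrite ?inE; [exact: measurable_level_set|exact: measurable_level_set tw.1|].
move=> x [x0 h]; split => //; rewrite ltNge; apply/negP => wl; move: h.
by rewrite ltNge ler_wpM2l.
Qed.

Lemma tame_scale w (c : R) : tame w -> 0 <= c -> tame (fun x => c * w x).
Proof.
move=> tw c0; split; first exact: measurable_funM tw.1.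
move=> t t0; apply: le_lt_trans (rearr_scale_le tw c0 t0) _.
by rewrite (rearr_fineE tw t0) -EFinM ltry.
Qed.

Lemma rearr_integral_scale_le w (c t : R) : tame w -> 0 <= c ->
  (K (fun x => (c * w x)%R) t <= c%:E * K w t)%E.
Proof.
move=> tw c0; rewrite -ge0_integralZl//.
apply: ge0_le_integral => //.
- exact: (@emeasurable_funM _ _ _ _ (fun=> c%:E)).
- by move=> x; rewrite initialE => /andP[x0 _]; exact: rearr_scale_le.
Qed.

Lemma measurable_sqrt_comp w (D : set T) : measurable_fun D w ->
  measurable_fun D (fun x => Num.sqrt (w x)).
Proof. by move=> mw; exact: (measurableT_comp (@measurable_sqrt R) mw). Qed.

Lemma level_measure_sqrt w (s : R) : 0 <= s ->
  dist (fun x => Num.sqrt (w x)) s = dist w (s ^+ 2).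
Proof.
by move=> s0; congr (mu _); apply/seteqP; split => x /= [x0]; rewrite sqrt_ltP.
Qed.

(** The square root is an increasing bijection of the nonnegative numbers, so
    that both inequalities follow from the adjunction [rearr_leP]. *)
Lemma rearr_sqrt w (t : R) : tame w -> 0 < t ->
  rs (fun x => Num.sqrt (w x)) t = (Num.sqrt (fine (rs w t)))%:E.
Proof.
move=> tw t0; have mw := tw.1; have ms := measurable_sqrt_comp mw.
set l := fine _; have l0 : 0 <= l by rewrite fine_ge0 ?rearr_ge0.
have le1 : (rs (fun x => Num.sqrt (w x)) t <= (Num.sqrt l)%:E)%E.
  by rewrite rearr_leP ?sqrtr_ge0// level_measure_sqrt ?sqrtr_ge0// sqr_sqrtr// -rearr_leP// /l -rearr_fineE.
apply/le_anti; rewrite le1/=.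
have fs : rs (fun x => Num.sqrt (w x)) t \is a fin_num.
  by rewrite ge0_fin_numE ?rearr_ge0// (le_lt_trans le1)// ltry.
rewrite -(fineK fs) lee_fin; set s := fine _.
have s0 : 0 <= s by rewrite fine_ge0 ?rearr_ge0.
rewrite leNgt sqrt_ltP// -leNgt -lee_fin /l -rearr_fineE// rearr_leP ?sqr_ge0//.
by rewrite -level_measure_sqrt// -rearr_leP// fineK.
Qed.

Lemma tame_sqrt w : tame w -> tame (fun x => Num.sqrt (w x)).
Proof.
move=> tw; split; first exact: measurable_sqrt_comp tw.1.
by move=> t t0; rewrite rearr_sqrt// ltry.
Qed.

Lemma rearr_integral_sqrt_le w (a t : R) : tame w -> 0 < a -> 0 < t ->
  (K (fun x => Num.sqrt (w x)) t <= ((2 * a)^-1)%:E * K w t + (a / 2 * t)%:E)%E.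
Proof.
move=> tw a0 t0; rewrite -(integral_cst_initial mr mu_r _ (ltW t0)).
have k0 : 0 <= (2 * a)^-1 by rewrite invr_ge0 mulr_ge0// ltW.
have mk : measurable_fun (ini t) (fun x => ((2 * a)^-1)%:E * rs w (r x))%E.
  exact: (@emeasurable_funM _ _ _ _ (fun=> ((2 * a)^-1)%:E)).
rewrite -ge0_integralZl//.
rewrite -ge0_integralD//; last first.
- by move=> x _; rewrite lee_fin divr_ge0// ltW.
- by move=> x _; rewrite mule_ge0 ?rearr_ge0.
apply: ge0_le_integral => //.
- exact: emeasurable_funD mk (measurable_cst _).
- move=> x; rewrite initialE => /andP[x0 _].
  rewrite rearr_sqrt// [X in (_ * X)%E](rearr_fineE tw x0) -EFinM -EFinD lee_fin sqrt_le_amgm//.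
  by rewrite fine_ge0.
Qed.

Lemma rearr_le_bound w (c t : R) : measurable_fun pos w -> 0 <= c -> 0 <= t ->
  {ae mu, forall x, 0 < r x -> w x <= c} -> (rs w t <= c%:E)%E.
Proof.
move=> mw c0 t0 wc; rewrite rearr_leP//.
apply: (@le_trans _ _ 0%E); last by rewrite lee_fin.
have [N [mN N0 hN]] := wc; rewrite -N0.
apply: le_measure; rewrite ?inE//; first exact: measurable_level_set.
move=> x [x0 cw]; apply: hN => /= /(_ x0); apply/negP; by rewrite -ltNge.
Qed.

Lemma ae_le_rearr_bound w (c : R) : measurable_fun pos w -> 0 <= c ->
  (forall t, 0 < t <= 1 -> (rs w t <= c%:E)%E) ->
  {ae mu, forall x, 0 < r x -> w x <= c}.
Proof.
move=> mw c0 h; exists [set x | 0 < r x /\ c < w x]; split.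
- exact: measurable_level_set.
- apply/eqP; rewrite eq_le measure_ge0 andbT.
  apply/lee_addgt0Pr => e e0; rewrite add0e.
  apply: (@le_trans _ _ (Num.min e 1)%:E); last by rewrite lee_fin ge_min lexx.
  by rewrite -[leLHS]/(dist w c) -rearr_leP// h// lt_min e0 ltr01 ge_min lexx orbT.
- move=> x /= /existsNP [x0 wx]; split => //.
  by rewrite ltNge; apply/negP.
Qed.

Lemma rearr_integral_le_bound w (c t : R) : 0 <= t ->
  (forall s, 0 < s -> (rs w s <= c%:E)%E) -> (K w t <= (c * t)%:E)%E.
Proof.
move=> t0 wc; rewrite -(integral_cst_initial mr mu_r _ t0).
apply: ge0_le_integral => //.
- by move=> x; rewrite initialE => /andP[x0 _]; exact: wc.
Qed.

Section weyl_rearrangement.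
Variables (u v : T -> R) (M : R).
Hypothesis tu : tame u.
Hypothesis tv : tame v.
Hypothesis vM : forall t, 0 < t -> (rs v t <= M%:E)%E.
Hypothesis iu : forall t, 0 < t ->
  mu.-integrable (ini t) (fun x => log_plus (rs u (r x))).
Hypothesis uv : forall t, 0 < t ->
  (\int[mu]_(x in ini t) lne (rs u (r x)) <=
   \int[mu]_(x in ini t) lne (rs v (r x)))%E.

Let a := fine \o rs u.
Let b := fine \o rs v.

Let fine_rs_ge0 w x : 0 <= fine (rs w x).
Proof. by rewrite fine_ge0 ?rearr_ge0. Qed.

Let fine_rs_nincr w x y : tame w -> 0 < x -> x <= y -> fine (rs w y) <= fine (rs w x).
Proof.
move=> tw x0 xy; rewrite -lee_fin -!rearr_fineE//; first exact: rearr_nincr.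
exact: lt_le_trans xy.
Qed.

Let bM x : 0 < x -> b x <= Num.max M 1.
Proof. by move=> x0; rewrite le_max -lee_fin -rearr_fineE// vM. Qed.

Let level s t : 0 <= s -> 0 < t -> exists2 c, 0 <= c <= t &
  forall y, 0 < y < t -> (s < a y) = (y < c).
Proof.
move=> s0 t0; exists (fine (mine (dist u s) t%:E)).
  have d0 : (0 <= mine (dist u s) t%:E)%E.
    by rewrite le_min measure_ge0 lee_fin ltW.
  rewrite fine_ge0//= -lee_fin fineK; first by rewrite ge_min lexx orbT.
  by rewrite ge0_fin_numE// gt_min ltry orbT.
move=> y /andP[y0 yt]; rewrite -lte_fin -rearr_fineE// rearr_gtP//; last exact: tu.1.
have d0 : (0 <= mine (dist u s) t%:E)%E.
  by rewrite le_min measure_ge0 lee_fin ltW.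
rewrite -lte_fin fineK; last by rewrite ge0_fin_numE// gt_min ltry orbT.
by rewrite lt_min [X in _ && X]lte_fin yt andbT.
Qed.

Let integral_rsE w (F : \bar R -> \bar R) (t : R) : tame w ->
  (\int[mu]_(x in ini t) F (rs w (r x)) =
   \int[mu]_(x in ini t) F (fine (rs w (r x)))%:E)%E.
Proof.
move=> tw; apply: eq_integral => x /set_mem; rewrite initialE => /andP[x0 _].
by rewrite -rearr_fineE.
Qed.

Let ia (t : R) : 0 < t -> mu.-integrable (ini t) (fun x => log_plus (a (r x))%:E).
Proof.
move=> t0; apply: eq_integrable (iu t0) => // x /set_mem.
by rewrite initialE => /andP[x0 _]; rewrite -rearr_fineE.
Qed.

Let ab (t : R) : 0 < t ->
  (\int[mu]_(x in ini t) lne (a (r x))%:E <=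
   \int[mu]_(x in ini t) lne (b (r x))%:E)%E.
Proof. by move=> t0; rewrite -!integral_rsE//; exact: uv. Qed.

Lemma weyl_rearr_integral (t : R) : 0 < t -> (K u t <= K v t)%E.
Proof.
move=> t0; rewrite /rearr_integral (integral_rsE id)// (integral_rsE id _ tv).
apply: (weyl mr mu_r (A := a) (B := b) (M := Num.max M 1)).
- by rewrite lt_max ltr01 orbT.
- by move=> x _; exact: fine_rs_ge0.
- by move=> x _; exact: fine_rs_ge0.
- by move=> x y; exact: fine_rs_nincr.
- by move=> x y; exact: fine_rs_nincr.
- exact: bM.
- exact: level.
- exact: ia.
- exact: ab.
- exact: t0.
Qed.

(** Taking square roots halves the logarithms, so that the hypotheses of [weyl]
    pass to the roots. *)
Lemma weyl_rearr_integral_sqrt (t : R) : 0 < t ->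
  (K (fun x => Num.sqrt (u x)) t <= K (fun x => Num.sqrt (v x)) t)%E.
Proof.
move=> t0.
have KE w : tame w -> (K (fun x => Num.sqrt (w x)) t =
    \int[mu]_(x in ini t) (Num.sqrt (fine (rs w (r x))))%:E)%E.
  move=> tw; apply: eq_integral => x /set_mem; rewrite initialE => /andP[x0 _].
  by rewrite rearr_sqrt.
have mrs w s : tame w -> measurable_fun (ini s) (fun x => lne (fine (rs w (r x)))%:E).
  move=> tw; apply: (measurable_nincr mr (f := fun y => lne (fine (rs w y))%:E)).
    exact: initial_half_line.
  move=> x y x0 xy; rewrite lee_lne ?in_itv/= ?lee_fin ?leey ?andbT ?fine_rs_ge0//.
  exact: fine_rs_nincr.
rewrite (KE u tu) (KE v tv).
apply: (weyl mr mu_r (A := Num.sqrt \o a) (B := Num.sqrt \o b)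
  (M := Num.sqrt (Num.max M 1))).
- by rewrite sqrtr_gt0 lt_max ltr01 orbT.
- by move=> x _; exact: sqrtr_ge0.
- by move=> x _; exact: sqrtr_ge0.
- by move=> x y x0 xy /=; rewrite ler_wsqrtr//; exact: fine_rs_nincr.
- by move=> x y x0 xy /=; rewrite ler_wsqrtr//; exact: fine_rs_nincr.
- by move=> x x0 /=; rewrite ler_wsqrtr//; exact: bM.
- move=> s t' s0 t'0; have [c c0 hc] := level (sqr_ge0 s) t'0.
  by exists c => // y yt /=; rewrite sqrt_ltP// hc.
- move=> s s0; apply: le_integrable (ia s0) => //.
    apply: measurable_maxe => //.
    rewrite (_ : (fun x => _) = fun x => ((2^-1)%:E * lne (a (r x))%:E)%E).
      by apply: (@emeasurable_funM _ _ _ _ (fun=> (2^-1)%:E)) => //; exact: mrs.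
    by apply/funext => x; rewrite -lne_sqrt.
  move=> x; rewrite initialE => /andP[x0 _]; rewrite /log_plus [(Num.sqrt \o a) _]/comp lne_sqrt.
  have m0 (y : \bar R) : (0 <= maxe y 0)%E by rewrite le_max lexx orbT.
  rewrite !gee0_abs//.
  case: (lne _) => [l| |].
  + rewrite -EFinM -!EFin_max lee_fin ge_max. apply/andP; split; last first.
      by rewrite le_max lexx orbT.
    by rewrite le_max; case: (leP l 0) => l0; apply/orP; [right|left]; lra.
  + by rewrite maxye leey.
  + by rewrite gt0_muleNy ?lte_fin ?invr_gt0// !maxNye.
- move=> s s0.
  have fE (g : R -> R) : (\int[mu]_(x in ini s) lne ((Num.sqrt \o g) (r x))%:E =
      \int[mu]_(x in ini s) ((2^-1)%:E * lne (g (r x))%:E))%E.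
    by apply: eq_integral => x _; rewrite -lne_sqrt.
  have fposE w : (fun x => lne (fine (rs w (r x)))%:E)^\+%E =
      (fun x => log_plus (fine (rs w (r x)))%:E).
    by apply/funext => x; rewrite funeposE.
  have half0 : 0 <= 2^-1 :> R by rewrite invr_ge0.
  have posv : (\int[mu]_(x in ini s) ((fun x => lne (b (r x))%:E)^\+ x) < +oo)%E.
    rewrite fposE; apply: (@le_lt_trans _ _ (\int[mu]_(x in ini s) `|ln (Num.max M 1)|%:E)%E).
      apply: ge0_le_integral.
      * exact: measurable_initial.
      * by move=> x _; rewrite le_max lexx orbT.
      * by apply: measurable_maxe; [exact: mrs|exact: measurable_cst].
      * exact: measurable_cst.
      * move=> x; rewrite initialE => /andP[x0 _]; rewrite ge_max lee_fin normr_ge0 andbT.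
        have [bx|bx] := leP (b (r x)) 0; first by rewrite le0_lneNy ?leNye ?lee_fin.
        rewrite lne_EFin// lee_fin; apply: le_trans (ler_norm _).
        by rewrite ler_ln ?posrE ?bM// lt_max ltr01 orbT.
    by rewrite (integral_cst_initial mr mu_r _ (ltW s0)) ltry.
  have posu : (\int[mu]_(x in ini s) ((fun x => lne (a (r x))%:E)^\+ x) < +oo)%E.
    rewrite fposE; have /integrableP[_] := ia s0; apply: le_lt_trans.
    have mp : measurable_fun (ini s) (fun x => log_plus (a (r x))%:E).
      by apply: measurable_maxe; [exact: mrs|exact: measurable_cst].
    apply: ge0_le_integral.
    * exact: measurable_initial.
    * by move=> x _; rewrite le_max lexx orbT.
    * exact: mp.
    * exact: (measurableT_comp _ mp).
    * by move=> x _; exact: lee_abs.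
  rewrite (fE a) (fE b).
  rewrite (integralZl_pos_part (measurable_initial mr s) (mrs u s tu) half0 posu).
  rewrite (integralZl_pos_part (measurable_initial mr s) (mrs v s tv) half0 posv).
  by apply: lee_wpmul2l; [rewrite lee_fin|exact: ab].
- exact: t0.
Qed.

End weyl_rearrangement.
End rearrangement_calculus.

(** * A closed solid subspace of the Marcinkiewicz space *)

Section space.
Variables (d : measure_display) (T : measurableType d) (R : realType).
Variables (mu : {sigma_finite_measure set T -> \bar R}) (r : T -> R).
Hypothesis mr : measurable_fun setT r.
Hypothesis mu_r : forall t : R, 0 <= t -> mu (r @^-1` `]0, t[) = t%:E.
Variable m : nat -> R.
Hypothesis m_gt0 : forall n, 0 < m n.
Local Notation pos := (half_line r).
Local Notation ini := (initial r).
Local Notation rs := (rearrangement mu r).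
Local Notation tame := (tame mu r).
Local Notation K := (rearr_integral mu r).
Local Hint Extern 0 (measurable (initial _ _)) => exact: measurable_initial : core.
Local Hint Extern 0 (measurable (half_line _)) => exact: measurable_half_line : core.
Implicit Types u v w : T -> R.

Lemma psi_gt0 (t : R) : 0 < t -> 0 < psi t.
Proof.
rewrite /psi; case: ifPn => // t1 _; rewrite -ltNge in t1.
by rewrite addr_gt0// ln_gt0.
Qed.

Definition psi_norm w : \bar R :=
  ereal_sup [set ((psi t)^-1%:E * K w t)%E | t in [set t : R | 0 < t]].

Lemma psi_norm_leP w (c : R) :
  (psi_norm w <= c%:E)%E <-> forall t, 0 < t -> (K w t <= (c * psi t)%:E)%E.
Proof.
have E t : 0 < t -> ((psi t)^-1%:E * K w t <= c%:E)%E = (K w t <= (c * psi t)%:E)%E.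
  move=> t0; have p0 := psi_gt0 t0.
  by rewrite -(@lee_pmul2l _ (psi t)%:E)// muleA -EFinM mulfV ?gt_eqF// mul1e -EFinM mulrC.
split => [h t t0|h].
  by rewrite -E//; apply: le_trans h; apply: ereal_sup_ubound; exists t.
by apply: ge_ereal_sup => _ [t t0 <-]; rewrite E//; exact: h.
Qed.

Lemma psi_norm_ge0 w : (0 <= psi_norm w)%E.
Proof.
apply: (@le_trans _ _ ((psi 1)^-1%:E * K w 1)%E).
  by rewrite mule_ge0 ?rearr_integral_ge0// lee_fin invr_ge0 ltW// psi_gt0.
by apply: ereal_sup_ubound; exists 1 => //=.
Qed.

Lemma psi_normE w : (psi_norm w < +oo)%E -> psi_norm w = (fine (psi_norm w))%:E.
Proof. by move=> h; rewrite fineK// ge0_fin_numE ?psi_norm_ge0. Qed.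

Lemma rearr_le_psi_norm w (c t : R) : (psi_norm w <= c%:E)%E -> 0 < t -> (rs w t <= c%:E)%E.
Proof.
move=> /psi_norm_leP wc.
have h s : 0 < s -> s <= 1 -> (rs w s <= c%:E)%E.
  move=> s0 s1; rewrite -(@lee_pmul2r _ s%:E)// -EFinM.
  have := wc _ s0; rewrite /psi s1; apply: le_trans.
  rewrite -(mu_r (ltW s0)) -(integral_cst mu (measurable_initial mr s) (rs w s)).
  apply: ge0_le_integral => //.
  - by move=> x _; exact: rearr_ge0.
  - exact: measurable_rearr_initial.
  - by move=> x; rewrite initialE => /andP[x0 xt]; apply: rearr_nincr; exact: ltW.
move=> t0; have [t1|t1] := leP t 1; first exact: h.
by apply: le_trans (h 1 ltr01 (lexx _)); apply: rearr_nincr; exact: ltW.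
Qed.

Lemma tame_psi_norm w : measurable_fun pos w -> (psi_norm w < +oo)%E -> tame w.
Proof.
move=> mw wfin; split => // t t0.
apply: (@le_lt_trans _ _ (fine (psi_norm w))%:E); last exact: ltry.
by apply: rearr_le_psi_norm; rewrite -?psi_normE.
Qed.

(** Here [psi t = t] for small [t] is used: the norm bounds the rearrangement
    near zero, hence the essential supremum. *)
Lemma ae_le_psi_norm w (c : R) : measurable_fun pos w -> (psi_norm w <= c%:E)%E ->
  {ae mu, forall x, 0 < r x -> w x <= c}.
Proof.
move=> mw wc; apply: ae_le_rearr_bound => //.
- by rewrite -lee_fin; apply: le_trans wc; exact: psi_norm_ge0.
- by move=> t /andP[t0 _]; exact: rearr_le_psi_norm.
Qed.

Lemma le_psi_norm u v : (forall t, 0 < t -> (K u t <= K v t)%E) -> (psi_norm u <= psi_norm v)%E.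
Proof.
move=> uv; apply: ge_ereal_sup => _ [t t0 <-].
apply: (@le_trans _ _ ((psi t)^-1%:E * K v t)%E); last first.
  by apply: ereal_sup_ubound; exists t.
by apply: lee_wpmul2l; [rewrite lee_fin invr_ge0 ltW// psi_gt0|exact: uv].
Qed.

Lemma psi_normD u v : tame u -> tame v -> (psi_norm (fun x => u x + v x)%R <= psi_norm u + psi_norm v)%E.
Proof.
move=> tu tv; apply: ge_ereal_sup => _ [t t0 <-].
have p0 : (0 <= (psi t)^-1%:E)%E by rewrite lee_fin invr_ge0 ltW// psi_gt0.
apply: (@le_trans _ _ ((psi t)^-1%:E * (K u t + K v t))%E).
  by apply: lee_wpmul2l => //; exact: rearr_integralD.
rewrite ge0_muleDr ?rearr_integral_ge0// leeD//; by apply: ereal_sup_ubound; exists t.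
Qed.

Lemma psi_norm_scale_le w (c : R) : tame w -> 0 <= c ->
  (psi_norm (fun x => c * w x)%R <= c%:E * psi_norm w)%E.
Proof.
move=> tw c0; apply: ge_ereal_sup => _ [t t0 <-].
have p0 : (0 <= (psi t)^-1%:E)%E by rewrite lee_fin invr_ge0 ltW// psi_gt0.
apply: (@le_trans _ _ ((psi t)^-1%:E * (c%:E * K w t))%E).
  by apply: lee_wpmul2l => //; exact: rearr_integral_scale_le.
by rewrite muleCA lee_wpmul2l//; apply: ereal_sup_ubound; exists t.
Qed.

(** If [K w t <= e * psi t], comparing [sqrt] with a suitable tangent line
    bounds the integral of [sqrt w^*] by [sqrt (e * t * psi t)]. *)
Lemma rearr_integral_sqrt_le_psi_norm w (e t : R) : tame w -> 0 < e -> 0 < t ->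
  (psi_norm w <= e%:E)%E ->
  (K (fun x => Num.sqrt (w x)) t <= (Num.sqrt e * Num.sqrt (t * psi t))%:E)%E.
Proof.
move=> tw e0 t0 /psi_norm_leP we; have p0 := psi_gt0 t0.
rewrite -sqrtrM; last exact: ltW.
set S := Num.sqrt _.
have S2 : S ^+ 2 = e * (t * psi t) by rewrite sqr_sqrtr// ltW// !mulr_gt0.
have S0 : 0 < S by rewrite sqrtr_gt0 !mulr_gt0.
have a0 : 0 < S / t by rewrite divr_gt0.
apply: (le_trans (rearr_integral_sqrt_le mr mu_r tw a0 t0)).
have i0 : (0 <= ((2 * (S / t))^-1)%:E)%E by rewrite lee_fin invr_ge0 mulr_ge0// ltW.
apply: (le_trans (leeD2r _ (lee_wpmul2l i0 (we _ t0)))).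
rewrite -EFinM -EFinD lee_fin.
have -> : e * psi t = S ^+ 2 / t by rewrite S2; field; rewrite gt_eqF.
by rewrite le_eqVlt; apply/orP; left; apply/eqP; field; rewrite !gt_eqF.
Qed.

Lemma rearr_integral_sqrtD u v (t : R) : tame u -> tame v -> 0 < t ->
  (forall x, 0 <= u x) -> (forall x, 0 <= v x) ->
  (K (fun x => Num.sqrt (u x + v x)) t <=
   K (fun x => Num.sqrt (u x)) t + K (fun x => Num.sqrt (v x)) t)%E.
Proof.
move=> tu tv t0 u0 v0; have tuv := tameD mr tu tv.
have su := tame_sqrt mr tu; have sv := tame_sqrt mr tv.
apply: le_trans (rearr_integralD mr mu_r su sv t0).
apply: le_rearr_integral => // s s0; apply: le_rearr => //.
- move=> x _; rewrite -(@ler_pXn2r _ 2) ?nnegrE ?sqrtr_ge0 ?addr_ge0 ?sqrtr_ge0//.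
  rewrite sqrrD !sqr_sqrtr ?addr_ge0// [leRHS]addrAC lerDl.
  by rewrite mulrn_wge0 ?mulr_ge0 ?sqrtr_ge0.
- exact: (tame_sqrt mr tuv).1.
- exact: (tameD mr su sv).1.
Qed.

Local Opaque psi_norm.

(** The root means along [m] are negligible with respect to the largest order
    that [rearr_integral_sqrt_le_psi_norm] allows. *)
Definition small_root_means w : Prop := forall e : R, 0 < e ->
  exists n0, forall n, (n0 <= n)%N ->
    (K (fun x => Num.sqrt (w x)) (m n) <= (e * Num.sqrt (m n * psi (m n)))%:E)%E.

Definition sparse w : Prop := [/\ measurable_fun pos w, (psi_norm w < +oo)%E & small_root_means w].

Lemma sparse_psi_norm w : sparse w -> (psi_norm w < +oo)%E.
Proof. by case. Qed.

Lemma sparse_tame w : sparse w -> tame w.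
Proof. by case=> mw wfin _; exact: tame_psi_norm. Qed.

Lemma sparse_le_rearr u v : measurable_fun pos u ->
  (forall t, 0 < t -> (rs u t <= rs v t)%E) -> sparse v -> sparse u /\ (psi_norm u <= psi_norm v)%E.
Proof.
move=> mu_ uv Xv; have tv := sparse_tame Xv; case: Xv => mv vfin sv.
have tu := tame_le uv mu_ tv.
have nuv : (psi_norm u <= psi_norm v)%E by apply: le_psi_norm => t _; exact: le_rearr_integral.
split; last exact: nuv.
split; [exact: mu_|exact: le_lt_trans nuv vfin|].
move=> e /sv [n0 h]; exists n0 => n /h; apply: le_trans; apply: le_rearr_integral => // t t0.
rewrite !rearr_sqrt// lee_fin ler_wsqrtr//.
by rewrite -lee_fin -!rearr_fineE//; exact: uv.
Qed.

Lemma sparse0 w : measurable_fun pos w -> (forall t, 0 < t -> (rs w t <= 0)%E) ->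
  sparse w /\ psi_norm w = 0%E.
Proof.
move=> mw w0.
have tw : tame w by split => // t /w0 /le_lt_trans; apply; exact: ltry.
have n0 : psi_norm w = 0%E.
  apply/le_anti; rewrite psi_norm_ge0 andbT; apply/psi_norm_leP => t t0.
  by rewrite mul0r -[0](mul0r t); apply: rearr_integral_le_bound => //; exact: ltW.
split; last exact: n0.
split; [exact: mw|by rewrite n0 ltry|move=> e e0; exists 0%N => n _].
apply: (@le_trans _ _ (0 * m n)%:E).
  apply: rearr_integral_le_bound => //; first exact: ltW.
  move=> t t0; rewrite rearr_sqrt// (_ : rs w t = 0%E) ?sqrtr0//.
  by apply/le_anti; rewrite w0// rearr_ge0.
by rewrite mul0r lee_fin mulr_ge0 ?sqrtr_ge0// ltW.
Qed.

Lemma sparseD u v : sparse u -> sparse v -> (forall x, 0 <= u x) -> (forall x, 0 <= v x) ->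
  sparse (fun x => u x + v x).
Proof.
move=> Xu Xv u0 v0; have tu := sparse_tame Xu; have tv := sparse_tame Xv.
case: Xu Xv => [mu_ ufin su] [mv vfin sv].
split; [exact: (tameD mr tu tv).1| |].
  exact: le_lt_trans (psi_normD tu tv) (lte_add_pinfty ufin vfin).
move=> e e0; have e2 : 0 < e / 2 by rewrite divr_gt0.
have [n1 h1] := su _ e2; have [n2 h2] := sv _ e2.
exists (maxn n1 n2) => n; rewrite geq_max => /andP[/h1 {}h1 /h2 {}h2].
apply: le_trans (rearr_integral_sqrtD tu tv (m_gt0 n) u0 v0) _.
by apply: le_trans (leeD h1 h2) _; rewrite -EFinD -mulrDl -splitr.
Qed.

Lemma sparse_scale w (c : R) : sparse w -> 0 <= c -> sparse (fun x => c * w x).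
Proof.
move=> Xw c0; have tw := sparse_tame Xw; case: Xw => mw wfin sw.
split; [exact: (tame_scale mr tw c0).1| |].
  apply: le_lt_trans (psi_norm_scale_le tw c0) _.
  by rewrite psi_normE// -EFinM ltry.
move=> e e0; have c1 : 0 < Num.sqrt c + 1 by rewrite ltr_wpDl ?sqrtr_ge0.
have [n0 h] := sw _ (divr_gt0 e0 c1); exists n0 => n /h {}h.
under eq_fun do rewrite sqrtrM//.
apply: le_trans (rearr_integral_scale_le mr _ (tame_sqrt mr tw) (sqrtr_ge0 c)) _.
apply: le_trans (lee_wpmul2l _ h) _; first by rewrite lee_fin sqrtr_ge0.
rewrite -EFinM lee_fin mulrA; apply: ler_wpM2r; first exact: sqrtr_ge0.
rewrite mulrCA ler_piMr ?(ltW e0)// ler_pdivrMr// mul1r.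
by rewrite lerDl.
Qed.

(** Closedness for the norm: the root means of the remainder [b] are at most
    [sqrt e] times the extreme order. *)
Lemma sparse_closed w : measurable_fun pos w -> (forall x, 0 <= w x) ->
  (forall e : R, 0 < e -> exists v b : T -> R,
    [/\ sparse v, (forall x, 0 <= v x), measurable_fun pos b, (forall x, 0 <= b x) &
      (psi_norm b <= e%:E)%E /\ forall x, 0 < r x -> w x <= v x + b x]) ->
  sparse w.
Proof.
move=> mw w0 h.
have aux e : 0 < e -> exists v b : T -> R,
    [/\ sparse v, (forall x, 0 <= v x), tame b, (forall x, 0 <= b x) &
      (psi_norm b <= e%:E)%E /\ forall t, 0 < t -> (rs w t <= rs (fun x => (v x + b x)%R) t)%E].
  move=> /h [v [b [Xv v0 mb b0 [be wvb]]]]; exists v, b.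
  have tb : tame b by apply: tame_psi_norm => //; exact: le_lt_trans be (ltry _).
  split => //; split => // t t0; apply: le_rearr => //.
  exact: (tameD mr (sparse_tame Xv) tb).1.
have [tw wfin] : tame w /\ (psi_norm w < +oo)%E.
  have [v [b [Xv v0 tb b0 [be wvb]]]] := aux 1 ltr01; have tv := sparse_tame Xv.
  split; first exact: tame_le wvb mw (tameD mr tv tb).
  apply: (@le_lt_trans _ _ (psi_norm v + psi_norm b)%E).
    by apply: le_trans (psi_normD tv tb); apply: le_psi_norm => t _; exact: le_rearr_integral.
  case: Xv => _ vfin _; exact: lte_add_pinfty vfin (le_lt_trans be (ltry _)).
split; [exact: mw|exact: wfin|move=> e e0].
have e2 : 0 < e / 2 by rewrite divr_gt0.
have [v [b [Xv v0 tb b0 [be wvb]]]] := aux _ (exprn_gt0 2 e2).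
have tv := sparse_tame Xv; case: Xv => _ _ /(_ _ e2) [n0 sv].
exists n0 => n /sv {}sv; have m0 := m_gt0 n.
have tvb := tameD mr tv tb.
apply: (@le_trans _ _ (K (fun x => Num.sqrt (v x + b x)) (m n))).
  apply: le_rearr_integral => // t t0; rewrite !rearr_sqrt// lee_fin ler_wsqrtr//.
  by rewrite -lee_fin -!rearr_fineE//; exact: wvb.
apply: le_trans (rearr_integral_sqrtD tv tb m0 v0 b0) _.
have := rearr_integral_sqrt_le_psi_norm tb (exprn_gt0 2 e2) m0 be.
rewrite sqrtr_sqr (ger0_norm (ltW e2)) => sb.
by apply: le_trans (leeD sv sb) _; rewrite -EFinD -mulrDl -splitr.
Qed.

(** The role of the Fatou lemma, for limits that are uniform off a null set: a
    uniformly small [b] adds at most [e' * t] to the integral up to [t]. *)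
Lemma psi_norm_limit w (e : R) : measurable_fun pos w ->
  (forall e' : R, 0 < e' -> exists v b : T -> R,
    [/\ tame v, measurable_fun pos b, (psi_norm v <= e%:E)%E,
      {ae mu, forall x, 0 < r x -> b x <= e'} &
      forall x, 0 < r x -> w x <= v x + b x]) ->
  (psi_norm w <= e%:E)%E.
Proof.
move=> mw h; apply/psi_norm_leP => t t0; apply/lee_addgt0Pr => e' e'0.
have et : 0 < e' / t by rewrite divr_gt0.
have [v [b [tv mb ve be wvb]]] := h _ et.
have bb s : 0 < s -> (rs b s <= (e' / t)%:E)%E.
  by move=> s0; apply: rearr_le_bound => //; exact: ltW.
have tb : tame b by split => // s s0; apply: le_lt_trans (bb _ s0) (ltry _).
apply: (@le_trans _ _ (K (fun x => v x + b x)%R t)).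
  by apply: le_rearr_integral => // s s0; apply: le_rearr => //; exact: (tameD mr tv tb).1.
apply: le_trans (rearr_integralD mr mu_r tv tb t0) _; apply: leeD.
  by move/psi_norm_leP : ve; exact.
by apply: le_trans (rearr_integral_le_bound mr mu_r (ltW t0) bb) _; rewrite divfK ?gt_eqF.
Qed.

(** A decreasing function that is infinite at [t] is infinite on all of
    [(0, t)]. *)
Lemma tame_log_integrable u : measurable_fun pos u ->
  (forall t, 0 < t -> mu.-integrable (ini t) (fun x => log_plus (rs u (r x)))) ->
  tame u.
Proof.
move=> mu_ iu; split => // t t0; rewrite ltey; apply/eqP => rt.
have [B [mB B0 hB]] := integrable_ae (measurable_initial mr t) (iu _ t0).
have : (mu (ini t) <= mu B)%E.
  apply: le_measure; rewrite ?inE//.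
  move=> x xt; apply: hB => /= /(_ xt); move: xt; rewrite initialE => /andP[_ xt].
  have -> : rs u (r x) = +oo%E.
    by apply/eqP; rewrite -leye_eq -rt; apply: rearr_nincr; exact: ltW.
  by rewrite /log_plus/= maxye.
by rewrite [X in (_ <= X)%E]B0 [X in (X <= _)%E](mu_r (ltW t0)) lee_fin leNgt t0.
Qed.

(** The first power of [weyl] controls the norm, the square root controls the
    root means. *)
Lemma sparse_weyl u v : tame u -> sparse v ->
  (forall t, 0 < t -> mu.-integrable (ini t) (fun x => log_plus (rs u (r x)))) ->
  (forall t, 0 < t -> (\int[mu]_(x in ini t) lne (rs u (r x)) <=
     \int[mu]_(x in ini t) lne (rs v (r x)))%E) ->
  sparse u /\ (psi_norm u <= psi_norm v)%E.
Proof.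
move=> tu Xv iu uv; have tv := sparse_tame Xv; case: Xv => mv vfin sv.
have vM t : 0 < t -> (rs v t <= (fine (psi_norm v))%:E)%E.
  by apply: rearr_le_psi_norm; rewrite -psi_normE.
have nuv : (psi_norm u <= psi_norm v)%E.
  by apply: le_psi_norm => t t0; exact: (weyl_rearr_integral mr mu_r tu tv vM iu uv).
split; last exact: nuv.
split; [exact: tu.1|exact: le_lt_trans nuv vfin|].
move=> e /sv [n0 h]; exists n0 => n /h; apply: le_trans.
exact: (weyl_rearr_integral_sqrt mr mu_r tu tv vM iu uv).
Qed.

End space.

(** * Decreasing functions and lacunary step functions *)

Section decreasing_functions.
Variables (d : measure_display) (T : measurableType d) (R : realType).
Variables (mu : {sigma_finite_measure set T -> \bar R}) (r : T -> R).
Hypothesis mr : measurable_fun setT r.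
Hypothesis mu_r : forall t : R, 0 <= t -> mu (r @^-1` `]0, t[) = t%:E.
Local Notation pos := (half_line r).
Local Notation ini := (initial r).
Local Notation rs := (rearrangement mu r).
Local Notation tame := (tame mu r).
Local Notation K := (rearr_integral mu r).
Local Hint Extern 0 (measurable (initial _ _)) => exact: measurable_initial : core.
Local Hint Extern 0 (measurable (half_line _)) => exact: measurable_half_line : core.

Definition decreasing_on_pos (p : R -> R) :=
  (forall x, 0 < x -> 0 <= p x) /\
  (forall x y, 0 < x -> x <= y -> p y <= p x).

Implicit Type p q : R -> R.

Lemma measurable_decreasing p (D : set T) : decreasing_on_pos p -> D `<=` pos ->
  measurable_fun D (p \o r).
Proof.
move=> [_ p_ni] Dp; apply/measurable_EFinP.
by apply: (measurable_nincr mr (f := EFin \o p) Dp) => x y x0 xy; rewrite lee_fin p_ni.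
Qed.

(** Level sets of levels below [p t] contain [(0, t')], whose measure exceeds
    [t]; the level set of [p t] is within [(0, t)]. *)
Lemma rearr_decreasing p (t : R) : decreasing_on_pos p -> 0 < t ->
  (exists2 t', t < t' & p t' = p t) -> rs (p \o r) t = (p t)%:E.
Proof.
move=> pd t0 [t' tt' pt']; have [p0 p_ni] := pd.
have mp : measurable_fun pos (p \o r) by exact: measurable_decreasing.
apply/le_anti/andP; split.
  rewrite rearr_leP ?p0// -(mu_r (ltW t0)); apply: le_measure; rewrite ?inE//.
  - exact: measurable_level_set.
  - exact: measurable_preimage_itv.
  - move=> x /= [x0 px]; rewrite in_itv/= x0 ltNge; apply/negP => tx.
    by move: px; rewrite ltNge p_ni.
apply: le_ereal_inf_tmp => _ [s [s0 st]] <-; rewrite lee_fin leNgt; apply/negP => sp.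
have : (t'%:E <= t%:E)%E.
  apply: le_trans st; rewrite -mu_r; last by rewrite ltW// (lt_trans t0).
  apply: le_measure; rewrite ?inE.
  - exact: measurable_preimage_itv.
  - exact: measurable_level_set.
  - move=> x /=; rewrite in_itv/= => /andP[x0 xt]; split => //.
    by rewrite (lt_le_trans sp)// -pt' p_ni// ltW.
by rewrite lee_fin leNgt tt'.
Qed.

Definition initial_integral p (t : R) : \bar R := (\int[mu]_(x in ini t) (p (r x))%:E)%E.
Local Notation J := initial_integral.

Lemma rearr_integral_decreasing p (t : R) : decreasing_on_pos p ->
  (forall s, 0 < s -> exists2 s', s < s' & p s' = p s) -> K (p \o r) t = J p t.
Proof.
move=> pd pc; apply: eq_integral => x /set_mem; rewrite initialE => /andP[x0 _].
by rewrite rearr_decreasing//; exact: pc.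
Qed.

Lemma initial_integral_split p (s t : R) : decreasing_on_pos p -> 0 < s -> s <= t ->
  (J p t = J p s + \int[mu]_(x in r @^-1` `[s, t[) (p (r x))%:E)%E.
Proof.
move=> pd s0 st; have [p0 _] := pd.
have Dp : ini s `|` r @^-1` `[s, t[ `<=` pos.
  move=> x [/initial_half_line//|/=]; rewrite half_lineE in_itv/= => /andP[sx _].
  exact: lt_le_trans sx.
rewrite /initial_integral -ge0_integral_setU//.
- congr (integral _ _ _); apply/seteqP; split => x; rewrite initialE.
    move=> /andP[x0 xt]; have [xs|sx] := ltP (r x) s.
      by left; rewrite initialE x0.
    by right; rewrite /= in_itv/= sx.
  case=> [|/=]; first by rewrite initialE => /andP[-> /lt_le_trans]; exact.
  by rewrite in_itv/= => /andP[sx ->]; rewrite (lt_le_trans s0).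
- exact: measurable_preimage_itv.
- by apply/measurable_EFinP; exact: measurable_decreasing.
- by move=> x /Dp; rewrite half_lineE => x0; rewrite lee_fin p0.
- apply/disj_setPS => x [/=]; rewrite initialE in_itv/= => /andP[_ xs] /andP[sx _].
  by move: xs; rewrite ltNge sx.
Qed.

Lemma measure_preimage_co (s t : R) : 0 < s -> s <= t ->
  mu (r @^-1` `[s, t[) = (t - s)%:E.
Proof.
move=> s0 st; have -> : r @^-1` `[s, t[ = ini t `\` ini s.
  apply/seteqP; split => x /=; rewrite !initialE in_itv/=.
    move=> /andP[sx xt]; rewrite xt (lt_le_trans s0 sx)/=; split => //.
    by rewrite ltNge sx.
  move=> [/andP[x0 xt]]; rewrite x0/= => /negP; rewrite -leNgt => sx.
  by rewrite sx.
have t0 : 0 <= t by rewrite (le_trans _ st)// ltW.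
rewrite measureD//; last by rewrite [ltLHS](mu_r t0) ltry.
rewrite setIidr; last exact: initialS.
by rewrite EFinB; congr (_ - _)%E; [exact: mu_r|exact: (mu_r (ltW s0))].
Qed.

Lemma integral_cst_co (c s t : R) : 0 < s -> s <= t ->
  (\int[mu]_(x in r @^-1` `[s, t[) c%:E = (c * (t - s))%:E)%E.
Proof.
move=> s0 st; rewrite (integral_cst mu (measurable_preimage_itv mr _) c%:E).
by rewrite EFinM -(measure_preimage_co s0 st).
Qed.

Lemma preimage_co_half_line (s t : R) : 0 < s -> r @^-1` `[s, t[ `<=` pos.
Proof.
move=> s0 x /=; rewrite half_lineE in_itv/= => /andP[sx _].
exact: lt_le_trans sx.
Qed.

Lemma initial_integral_le p (s t : R) : decreasing_on_pos p -> 0 < s -> s <= t ->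
  (J p t <= J p s + (p s * (t - s))%:E)%E.
Proof.
move=> pd s0 st; rewrite (initial_integral_split pd s0 st) leeD2l// -integral_cst_co//.
have [p0 p_ni] := pd; have sub := preimage_co_half_line (t := t) s0.
apply: ge0_le_integral => //.
- exact: measurable_preimage_itv.
- by move=> x /sub; rewrite half_lineE => x0; rewrite lee_fin p0.
- by apply/measurable_EFinP; exact: measurable_decreasing.
- by move=> x /=; rewrite in_itv/= => /andP[sx _]; rewrite lee_fin p_ni.
Qed.

Lemma initial_integral_ge p (b s t : R) : decreasing_on_pos p -> 0 < s -> s <= t -> 0 <= b ->
  (forall x, s <= x < t -> b <= p x) -> (J p s + (b * (t - s))%:E <= J p t)%E.
Proof.
move=> pd s0 st b0 bp; rewrite (initial_integral_split pd s0 st) leeD2l// -integral_cst_co//.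
have sub := preimage_co_half_line (t := t) s0.
apply: ge0_le_integral => //.
- exact: measurable_preimage_itv.
- by apply/measurable_EFinP; exact: measurable_decreasing.
- by move=> x /=; rewrite in_itv/= => /bp; rewrite lee_fin.
Qed.

Lemma initial_integral_mono p (s t : R) : decreasing_on_pos p -> 0 < s -> s <= t ->
  (J p s <= J p t)%E.
Proof.
move=> pd s0 st; rewrite -[leLHS]adde0 -[X in (_ + X)%E]/(0%:E) -(mul0r (t - s)).
apply: initial_integral_ge => // x /andP[sx _]; apply: pd.1; exact: lt_le_trans sx.
Qed.

Lemma le_initial_integral p q (t : R) : decreasing_on_pos p -> decreasing_on_pos q ->
  (forall x, 0 < x < t -> p x <= q x) -> (J p t <= J q t)%E.
Proof.
move=> pd qd pq; apply: ge0_le_integral => //.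
- by move=> x; rewrite initialE => /andP[x0 _]; rewrite lee_fin pd.1.
- by apply/measurable_EFinP; apply: measurable_decreasing => //; exact: initial_half_line.
- by apply/measurable_EFinP; apply: measurable_decreasing => //; exact: initial_half_line.
- by move=> x; rewrite initialE => /pq; rewrite lee_fin.
Qed.

Lemma initial_integral_cst (c t : R) : 0 <= t -> J (fun=> c) t = (c * t)%:E.
Proof. exact: integral_cst_initial. Qed.

End decreasing_functions.

Section step_function.
Variable R : realType.
Variables c l : R.
Hypothesis l1 : 1 <= l.
Hypothesis c0 : 0 < c.
Hypothesis c32 : 32 * c <= 1.
Hypothesis cl : c * l <= 1.

(** The ends of the blocks and the heights: a block of height [height n] and
    end [break n] has mass close to [c * log_break n], which is [c] times the
    logarithm of its end. *)
Definition log_break (n : nat) : R := l * 16 ^+ n.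
Definition break (n : nat) : R := expR (log_break n).
Definition height (n : nat) : R := c * log_break n / break n.

Lemma exp16_ge n : n%:R <= 16 ^+ n :> R.
Proof.
elim: n => [|n IH]; first by rewrite expr0.
rewrite -natr1 exprS; have : 1 <= 16 ^+ n :> R by rewrite exprn_ege1// ler1n.
by move: IH; lra.
Qed.

Lemma exp16_ge1 n : 1 <= 16 ^+ n :> R.
Proof. by rewrite exprn_ege1// ler1n. Qed.

Lemma log_breakS n : log_break n.+1 = 16 * log_break n.
Proof. by rewrite /log_break exprS mulrCA. Qed.

Lemma log_break_ge1 n : 1 <= log_break n.
Proof. by rewrite -[1]mul1r ler_pM// exp16_ge1. Qed.

Lemma break_gt0 n : 0 < break n. Proof. exact: expR_gt0. Qed.

Lemma break_gt1 n : 1 < break n.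
Proof. by rewrite expR_gt1 (lt_le_trans ltr01)// log_break_ge1. Qed.

Lemma break0_ge2 : 2 <= break 0.
Proof.
have := expR_ge1Dx (log_break 0); have := log_break_ge1 0; rewrite /break; lra.
Qed.

Lemma breakS_ge n : 16 * break n <= break n.+1.
Proof.
rewrite /break log_breakS (_ : 16 * log_break n = 15 * log_break n + log_break n); last by lra.
rewrite expRD ler_pM2r ?expR_gt0//.
have := expR_ge1Dx (15 * log_break n); have := log_break_ge1 n; lra.
Qed.

Lemma break_homo n k : (n <= k)%N -> break n <= break k.
Proof.
move=> /subnK <-; elim: (k - n)%N => // j IH; rewrite addSn (le_trans IH)//.
by apply: le_trans (breakS_ge _); have := break_gt0 (j + n); lra.
Qed.

Lemma break_unbounded x : exists n, x < break n.
Proof.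
exists (Num.truncn x).+1; have h := truncnS_gt x; apply: lt_le_trans h _.
apply: le_trans (exp16_ge _) _; set y := 16 ^+ _.
have y1 : 1 <= y by exact: exp16_ge1.
have : y <= log_break (Num.truncn x).+1.
  by rewrite /log_break -/y -[leLHS]mul1r ler_pM2r// (lt_le_trans ltr01).
have := expR_ge1Dx (log_break (Num.truncn x).+1); rewrite /break; lra.
Qed.

Definition idx x : nat := ex_minn (break_unbounded x).

Lemma idx_lt x : x < break (idx x).
Proof. by rewrite /idx; case: ex_minnP. Qed.

Lemma idx_le x n : x < break n -> (idx x <= n)%N.
Proof. by rewrite /idx; case: ex_minnP => k _ h /h. Qed.

Lemma idx_homo x y : x <= y -> (idx x <= idx y)%N.
Proof. by move=> xy; apply: idx_le; apply: le_lt_trans xy (idx_lt y). Qed.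

Lemma idx_eq x n : break n <= x -> x < break n.+1 -> idx x = n.+1.
Proof.
move=> nx xn; apply/eqP; rewrite eqn_leq idx_le//= ltnNge; apply/negP => h.
by move: (idx_lt x); rewrite ltNge (le_trans _ nx)// break_homo.
Qed.

Lemma break_interval x : break 0 <= x -> exists n, break n <= x < break n.+1.
Proof.
move=> x0; case E : (idx x) => [|n].
  by move: (idx_lt x); rewrite E ltNge x0.
exists n; rewrite -E idx_lt andbT leNgt; apply/negP => /idx_le.
by rewrite E ltnn.
Qed.

Lemma height_gt0 n : 0 < height n.
Proof.
by rewrite divr_gt0 ?break_gt0// mulr_gt0// (lt_le_trans ltr01)// log_break_ge1.
Qed.

Lemma c_log_break_ge0 n : 0 <= c * log_break n.
Proof. by rewrite mulr_ge0 ?(ltW c0)// (le_trans ler01)// log_break_ge1. Qed.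

Lemma heightM_break n : height n * break n = c * log_break n.
Proof. by rewrite divfK// gt_eqF// break_gt0. Qed.

Lemma heightS n : height n.+1 <= height n.
Proof.
rewrite /height log_breakS ler_pdivrMr ?break_gt0// mulrAC ler_pdivlMr ?break_gt0//.
have := ler_wpM2l (c_log_break_ge0 n) (breakS_ge n); nra.
Qed.

Lemma height_homo n k : (n <= k)%N -> height k <= height n.
Proof.
move=> /subnK <-; elim: (k - n)%N => // j IH.
by rewrite addSn (le_trans (heightS _)).
Qed.

Lemma height_le1 n : height n <= 1.
Proof.
rewrite (le_trans (height_homo (leq0n n)))// ler_pdivrMr ?break_gt0// mul1r.
rewrite /log_break expr0 mulr1; apply: le_trans cl _; exact: ltW (break_gt1 0).
Qed.

Definition step (x : R) : R := if x < 1 then 1 else height (idx x).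

Lemma step_decreasing : decreasing_on_pos step.
Proof.
split=> [x _|x y _ xy]; rewrite /step.
  by case: ifP => // _; rewrite ltW// height_gt0.
case: ifPn => y1; first by rewrite (le_lt_trans xy y1).
by case: ifPn => x1; [exact: height_le1|apply/height_homo/idx_homo].
Qed.

Lemma step_le1 x : step x <= 1.
Proof. by rewrite /step; case: ifP => // _; exact: height_le1. Qed.

Lemma step_lt1 x : x < 1 -> step x = 1.
Proof. by rewrite /step => ->. Qed.

Lemma step_height x n : x < break n -> height n <= step x.
Proof.
move=> xn; rewrite /step; case: ifP => _; first exact: height_le1.
by apply/height_homo/idx_le.
Qed.

Lemma step1 : step 1 = height 0.
Proof.
rewrite /step ltxx; congr height; apply/eqP; rewrite -leqn0; apply: idx_le.
exact: break_gt1.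
Qed.

Lemma step_break n : step (break n) = height n.+1.
Proof.
have b1 := break_gt1 n; rewrite /step ltNge ltW//=; congr height.
apply: idx_eq => //; apply: lt_le_trans (breakS_ge n).
by have := break_gt0 n; lra.
Qed.

Lemma step_right x : 0 < x -> exists2 y, x < y & step y = step x.
Proof.
move=> x0; have [x1|x1] := ltP x 1.
  exists ((x + 1) / 2); first by lra.
  by rewrite !step_lt1//; lra.
have xb := idx_lt x; exists ((x + break (idx x)) / 2); first by lra.
set y := (_ / 2); have xy : x <= y by rewrite /y; lra.
rewrite /step !ltNge x1 (le_trans x1 xy)/=; congr height.
apply/eqP; rewrite eqn_leq (idx_homo xy) andbT; apply: idx_le.
by rewrite /y; lra.
Qed.

Variables (d : measure_display) (T : measurableType d).
Variables (mu : {sigma_finite_measure set T -> \bar R}) (r : T -> R).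
Hypothesis mr : measurable_fun setT r.
Hypothesis mu_r : forall t : R, 0 <= t -> mu (r @^-1` `]0, t[) = t%:E.
Local Notation J := (initial_integral mu r).
Local Notation K := (rearr_integral mu r).

Lemma rearr_integral_step (t : R) : K (step \o r) t = J step t.
Proof.
by apply: (rearr_integral_decreasing mr mu_r) => [|s s0]; [exact: step_decreasing|exact: step_right].
Qed.

Lemma initial_integral_step_small (t : R) : 0 < t -> t <= 1 -> J step t = t%:E.
Proof.
move=> t0 t1; rewrite -[t in RHS]mul1r -(initial_integral_cst mr mu_r _ (ltW t0)).
apply: eq_integral => x /set_mem; rewrite initialE => /andP[_ xt].
by rewrite step_lt1// (lt_le_trans xt).
Qed.

(** The masses of the blocks form a geometric progression of ratio 16, so the
    total is comparable with the last one. *)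
Lemma initial_integral_step_break (n : nat) : (J step (break n) <= (1 + 2 * c * log_break n)%:E)%E.
Proof.
have pd := step_decreasing.
elim: n => [|n IH].
  apply: (le_trans (initial_integral_le mr mu_r pd ltr01 (ltW (break_gt1 0)))).
  rewrite initial_integral_step_small// -EFinD lee_fin step1.
  have := heightM_break 0; have := height_gt0 0; have := c_log_break_ge0 0; nra.
have bb : break n <= break n.+1 by exact: break_homo.
apply: (le_trans (initial_integral_le mr mu_r pd (break_gt0 n) bb)).
apply: (le_trans (leeD2r _ IH)); rewrite -EFinD lee_fin step_break.
have := heightM_break n.+1; rewrite log_breakS => h.
have := mulr_gt0 (height_gt0 n.+1) (break_gt0 n); have := c_log_break_ge0 n.
by rewrite mulrBr h; lra.
Qed.

Lemma initial_integral_step_break_ge (n : nat) :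
  ((1 + c / 2 * log_break n)%:E <= J step (break n))%E.
Proof.
have pd := step_decreasing.
case: n => [|n].
  apply: (le_trans _ (initial_integral_ge mr mu_r pd ltr01 (ltW (break_gt1 0)) (ltW (height_gt0 0)) _)).
    rewrite initial_integral_step_small// -EFinD lee_fin.
    have := heightM_break 0; have := height_gt0 0; have := break0_ge2; nra.
  by move=> x /andP[_]; exact: step_height.
have bb : break n <= break n.+1 by exact: break_homo.
apply: (le_trans _ (initial_integral_ge mr mu_r pd (break_gt0 n) bb (ltW (height_gt0 n.+1)) _)); last first.
  by move=> x /andP[_]; exact: step_height.
apply: (@le_trans _ _ (1%:E + (height n.+1 * (break n.+1 - break n))%:E)%E).
  rewrite -EFinD lee_fin; have := heightM_break n.+1.
  have := breakS_ge n; have := height_gt0 n.+1; nra.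
rewrite leeD2r// -(initial_integral_step_small ltr01 (lexx _)).
by apply: (initial_integral_mono mr mu_r pd ltr01); exact: ltW (break_gt1 n).
Qed.

(** On the first block this is [ln t >= 1 - t^-1]; later the mass up to the end
    of the current block is at most 1 plus [32 * c] times the logarithm of its
    beginning. *)
Lemma initial_integral_step_psi (t : R) : 0 < t -> (J step t <= (psi t)%:E)%E.
Proof.
move=> t0; have pd := step_decreasing; rewrite /psi.
case: ifPn => [t1|]; first by rewrite initial_integral_step_small.
rewrite -ltNge => t1.
have [tb|bt] := ltP t (break 0).
  apply: (le_trans (initial_integral_le mr mu_r pd ltr01 (ltW t1))).
  rewrite initial_integral_step_small// -EFinD lee_fin lerD2l step1.
  apply: (@le_trans _ _ (1 - t^-1)).
    have -> : 1 - t^-1 = (t - 1) / t by field; rewrite gt_eqF.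
    rewrite mulrC ler_wpM2l ?subr_ge0 ?(ltW t1)//.
    rewrite /height /log_break expr0 mulr1.
    apply: (@le_trans _ _ (1 / break 0)).
      by rewrite ler_pM2r// invr_gt0 break_gt0.
    by rewrite div1r lef_pV2 ?posrE ?break_gt0// ltW.
  have : ln (t^-1) <= t^-1 - 1.
    have := @le_ln1Dx R (t^-1 - 1); rewrite addrCA subrr addr0; apply.
    by rewrite ltrBrDl subrr invr_gt0.
  by rewrite lnV ?posrE//; lra.
have [n /andP[nt tn]] := break_interval bt.
apply: (le_trans (initial_integral_mono mr mu_r pd t0 (ltW tn))).
apply: (le_trans (initial_integral_step_break _)); rewrite lee_fin lerD2l log_breakS.
have : log_break n <= ln t by rewrite -[leLHS]expRK ler_ln ?posrE ?expR_gt0.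
have := ler_wpM2r (le_trans ler01 (log_break_ge1 n)) c32; lra.
Qed.

Lemma psi_norm_step : psi_norm mu r (step \o r) = 1%E.
Proof.
apply/le_anti/andP; split.
  by apply/psi_norm_leP => // t t0; rewrite rearr_integral_step mul1r; exact: initial_integral_step_psi.
apply: ereal_sup_ubound; exists 1 => //=.
by rewrite rearr_integral_step initial_integral_step_small// /psi lexx invr1 mul1e.
Qed.

End step_function.

(** * Two interlaced lacunary step functions *)

Section counterexample.
Variable R : realType.

Lemma one_le_four : 1 <= 4 :> R. Proof. by rewrite ler1n. Qed.

(** The sequence along which root means are taken: ends of the blocks of one
    step function, deep inside the blocks of the other, which reach from [B]
    to [B ^ 16] around [B ^ 4]. *)
Definition midpoint (n : nat) : R := break 4 n.

Lemma midpoint_gt0 n : 0 < midpoint n. Proof. exact: break_gt0. Qed.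

Lemma step_ge0 (c l x : R) (l1 : 1 <= l) : 0 < c -> 0 <= step c l1 x.
Proof.
by move=> c0; rewrite /step; case: ifP => // _; apply/ltW/height_gt0.
Qed.

Lemma log_break4 n : log_break 4 n = 4 * log_break (1 : R) n.
Proof. by rewrite /log_break mul1r. Qed.

Lemma midpointE n : midpoint n = break (1 : R) n ^+ 4.
Proof. by rewrite /midpoint /break log_break4 expRM_natl. Qed.

Lemma sqrt_decreasing (p : R -> R) : decreasing_on_pos p ->
  decreasing_on_pos (Num.sqrt \o p).
Proof.
move=> [p0 p_ni]; split=> [x _|x y x0 xy] /=; first exact: sqrtr_ge0.
by rewrite ler_wsqrtr// p_ni.
Qed.

Variables cf cg : R.
Hypothesis cf0 : 0 < cf.
Hypothesis cg0 : 0 < cg.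
Hypothesis cf32 : 32 * cf <= 1.
Hypothesis cgf : 16 * (16 * cg) <= cf.
Local Notation f := (step cf (lexx 1)).
Local Notation g := (step cg one_le_four).

Let cfl : cf * 1 <= 1.
Proof. by rewrite mulr1; apply: le_trans cf32; rewrite ler_peMl ?(ltW cf0)// ler1n. Qed.

Let cgl : cg * 4 <= 1.
Proof.
by move: cf32 cgf cg0; lra.
Qed.

Let f_dec : decreasing_on_pos f. Proof. exact: step_decreasing. Qed.
Let g_dec : decreasing_on_pos g. Proof. exact: step_decreasing. Qed.

Variables (d : measure_display) (T : measurableType d).
Variables (mu : {sigma_finite_measure set T -> \bar R}) (r : T -> R).
Hypothesis mr : measurable_fun setT r.
Hypothesis mu_r : forall t : R, 0 <= t -> mu (r @^-1` `]0, t[) = t%:E.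
Local Notation J := (initial_integral mu r).
Local Notation K := (rearr_integral mu r).

(** On the first block of [f] the comparison is pointwise; from there on the
    mass of [f] up to the beginning of its block is at least the mass of [g] up
    to the end of a later block, thanks to the factor 256 between the constants. *)
Lemma submaj_steps (t : R) : 0 < t -> (K (g \o r) t <= K (f \o r) t)%E.
Proof.
move=> t0.
have Kg : (K (g \o r) t <= J g t)%E by rewrite (rearr_integral_step one_le_four cg0 cgl mr mu_r t).
have Kf : (J f t <= K (f \o r) t)%E.
  rewrite (rearr_integral_step (lexx 1) cf0 cfl mr mu_r t); exact: lexx.
apply: (le_trans Kg); apply: le_trans Kf.
have [tb|bt] := ltP t (break 1 0).
  apply: (le_initial_integral mu mr g_dec f_dec) => x /andP[x0 xt]; have xb := lt_trans xt tb.
  have [x1|x1] := ltP x 1; first by rewrite !step_lt1.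
  apply: (@le_trans _ _ (height cf 1 0)); last exact: (step_height (lexx 1) cf0 cfl xb).
  apply: (le_trans (g_dec.2 _ _ ltr01 x1)); rewrite step1//.
  rewrite /height /log_break expr0 !mulr1; apply: ler_pM.
  - by rewrite mulr_ge0// ltW.
  - by rewrite invr_ge0 ltW// break_gt0.
  - by move: cgf cg0; lra.
  - rewrite lef_pV2 ?posrE ?break_gt0// -/(midpoint 0) midpointE exprS ler_peMr//.
      exact: ltW (break_gt0 _ _).
    by rewrite exprn_ege1// ltW// break_gt1.
have [n /andP[nt tn]] := break_interval (lexx 1) bt.
have tm : t <= break 4 n.+1.
  rewrite -/(midpoint n.+1) midpointE; apply: (le_trans (ltW tn)).
  rewrite exprS ler_peMr ?exprn_ege1// ltW ?break_gt0 ?break_gt1//.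
apply: (le_trans (initial_integral_mono mr mu_r g_dec t0 tm)).
apply: (le_trans (initial_integral_step_break one_le_four cg0 cgl mr mu_r _)).
apply: (le_trans _ (initial_integral_mono mr mu_r f_dec (break_gt0 1 n) nt)).
apply: (le_trans _ (initial_integral_step_break_ge (lexx 1) cf0 cfl mr mu_r _)).
rewrite lee_fin log_break4 log_breakS.
have := ler_wpM2r (le_trans ler01 (log_break_ge1 (lexx (1 : R)) n)) cgf; lra.
Qed.

Lemma rearr_integral_sqrt_step (c l t : R) (l1 : 1 <= l) : 0 < c -> c * l <= 1 ->
  K (fun x => Num.sqrt ((step c l1 \o r) x)) t = J (Num.sqrt \o step c l1) t.
Proof.
move=> c0 cl; apply: (rearr_integral_decreasing mr mu_r (p := Num.sqrt \o step c l1)).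
  exact/sqrt_decreasing/step_decreasing.
by move=> s s0; have [y sy yE] := step_right c l1 s0; exists y => //=; rewrite yE.
Qed.

(** With [B] the beginning of the block of [f] containing [m n = B ^ 4], the
    part before [B] contributes at most [B], and the height of the block is so
    small that the rest contributes at most [1]; the extreme order is at least
    [B ^ 2]. *)
Lemma small_f_step : small_root_means mu r midpoint (f \o r).
Proof.
move=> e e0; exists (Num.truncn (2 / e)).+1 => n ne.
rewrite rearr_integral_sqrt_step//; set B := break (1 : R) n.
have B1 : 1 < B by exact: break_gt1.
have B0 : 0 < B by exact: lt_trans B1.
have LB : 16 ^+ n <= B.
  have := expR_ge1Dx (log_break (1 : R) n).
  by rewrite -/(break 1 n) -/B /log_break mul1r; lra.
have Be : 2 <= e * B.
  rewrite mulrC -ler_pdivrMr//; apply: le_trans (ltW (truncnS_gt _)) _.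
  apply: (@le_trans _ _ n%:R); first by rewrite ler_nat.
  exact: le_trans (exp16_ge R n) LB.
have mB : midpoint n = B ^+ 4 by exact: midpointE.
have m1 : 1 <= midpoint n by exact: ltW (break_gt1 one_le_four n).
have Bm : B <= midpoint n by rewrite mB exprS ler_peMr ?exprn_ege1 ?ltW.
have pd := sqrt_decreasing f_dec.
have JB : (J (Num.sqrt \o f) B <= B%:E)%E.
  rewrite -[X in X%:E]mul1r -(initial_integral_cst mr mu_r _ (ltW B0)).
  apply: (le_initial_integral mu mr) => //.
  by move=> x _ /=; rewrite -[leRHS]sqrtr1 ler_wsqrtr// step_le1.
apply: le_trans (initial_integral_le mr mu_r pd B0 Bm) _.
apply: le_trans (leeD2r _ JB) _; rewrite -EFinD lee_fin.
have hB : Num.sqrt (f B) <= (B ^+ 4)^-1.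
  have b0 : 0 <= (B ^+ 4)^-1 by rewrite invr_ge0 exprn_ge0// ltW.
  rewrite -[leRHS](ger0_norm b0) -sqrtr_sqr ler_wsqrtr// step_break//.
  have B16 : break (1 : R) n.+1 = B ^+ 16.
    by rewrite /B /break log_breakS expRM_natl.
  rewrite /height B16 ler_pdivrMr ?exprn_gt0//.
  have -> : (B ^+ 4)^-1 ^+ 2 * B ^+ 16 = B ^+ 8.
    rewrite exprVn -exprM -[16%N]/(4 * 2 + 8)%N exprD mulKf//.
    by rewrite gt_eqF// exprn_gt0.
  apply: (@le_trans _ _ B); last by rewrite exprS ler_peMr ?exprn_ege1 ?ltW.
  apply: le_trans LB; rewrite log_breakS /log_break mul1r.
  have := ler_wpM2r (le_trans ler01 (exp16_ge1 R n)) cf32.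
  have := mulr_ge0 (ltW cf0) (le_trans ler01 (exp16_ge1 R n)); lra.
have S : B ^+ 2 <= Num.sqrt (midpoint n * psi (midpoint n)).
  have B2 : 0 <= B ^+ 2 by exact: sqr_ge0.
  rewrite -[leLHS](ger0_norm B2) -sqrtr_sqr ler_wsqrtr// -exprM -mB.
  rewrite ler_peMr ?(le_trans ler01 m1)// /psi; case: ifP => // _.
  by rewrite lerDl ln_ge0.
apply: (@le_trans _ _ (B + 1)).
  rewrite lerD2l; apply: (@le_trans _ _ ((B ^+ 4)^-1 * B ^+ 4)).
    apply: ler_pM => //; [exact: sqrtr_ge0|by rewrite subr_ge0|].
    by rewrite -mB lerBlDr lerDl ltW.
  by rewrite mulVf// gt_eqF// exprn_gt0.
apply: le_trans (ler_wpM2l (ltW e0) S).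
rewrite expr2 mulrA; have := ler_wpM2r (ltW B0) Be; lra.
Qed.

(** Before [m n], the end of a block of [g], the function [g] is at least the
    height of that block, which alone produces the extreme order. *)
Lemma not_small_g_step : ~ small_root_means mu r midpoint (g \o r).
Proof.
pose c : R := Num.sqrt (cg / 2).
have c0 : 0 < c by rewrite sqrtr_gt0 divr_gt0.
move=> /(_ (c / 2)) [|n0 /(_ n0 (leqnn _))]; first by rewrite divr_gt0.
rewrite rearr_integral_sqrt_step//; set M := midpoint n0; pose L := log_break (4 : R) n0.
have M0 : 0 < M by exact: midpoint_gt0.
pose h : R := Num.sqrt (height cg 4 n0).
have h_dec : decreasing_on_pos (fun=> h) by split => // x _; exact: sqrtr_ge0.
have hJ : ((h * M)%:E <= J (Num.sqrt \o g) M)%E.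
  rewrite -(initial_integral_cst mr mu_r _ (ltW M0)).
  apply: (le_initial_integral mu mr h_dec (sqrt_decreasing g_dec)) => x /andP[_ xM] /=.
  by rewrite ler_wsqrtr//; exact: (step_height one_le_four cg0 cgl).
move=> /(le_trans hJ); rewrite lee_fin leNgt => /negP; apply.
have L1 : 1 <= L by exact: (log_break_ge1 one_le_four n0).
have ML : psi M = 1 + L.
  by rewrite /psi leNgt (break_gt1 one_le_four n0)/= /M /midpoint /break expRK.
have MS : 0 < Num.sqrt (M * psi M) by rewrite sqrtr_gt0 mulr_gt0// psi_gt0.
apply: (@lt_le_trans _ _ (c * Num.sqrt (M * psi M))).
  by rewrite ltr_pM2r// ltr_pdivrMr// ltr_pMr// ltr1n.
rewrite /c /h -sqrtrM ?divr_ge0 ?(ltW cg0)//.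
rewrite -[M in leRHS](ger0_norm (ltW M0)) -sqrtr_sqr -sqrtrM ?(ltW (height_gt0 one_le_four cg0 n0))//.
rewrite ler_wsqrtr// expr2 mulrA heightM_break ML -/L.
have := ler_wpM2r (ltW M0) (ler_wpM2l (ltW cg0) L1); nra.
Qed.

End counterexample.

(** * Real and complex scalars *)

Section scalars.
Variables (R : realType) (k : scalar_kind).
Local Notation F := (scalar_field R k).
Implicit Types (z w : F) (x : R).

Definition sc_mk (k : scalar_kind) (x y : R) : scalar_field R k :=
  match k return scalar_field R k with
  | RealScalars => x
  | ComplexScalars => Complex x y
  end.

Lemma sc_absE z : sc_abs z = Num.sqrt (sc_re z ^+ 2 + sc_im z ^+ 2).
Proof.
case: k z => [z|[a b]]; rewrite /sc_abs/=; last by [].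
by rewrite expr0n addr0 sqrtr_sqr.
Qed.

Lemma sc_abs_ge0 z : 0 <= sc_abs z.
Proof. by rewrite sc_absE sqrtr_ge0. Qed.

Lemma sc_reD z w : sc_re (z + w) = sc_re z + sc_re w.
Proof. by case: k z w => [z w|[a b] [c e]]. Qed.

Lemma sc_imD z w : sc_im (z + w) = sc_im z + sc_im w.
Proof. by case: k z w => [z w|[a b] [c e]] //=; rewrite addr0. Qed.

Lemma sc_reN z : sc_re (- z) = - sc_re z.
Proof. by case: k z => [z|[a b]]. Qed.

Lemma sc_imN z : sc_im (- z) = - sc_im z.
Proof. by case: k z => [z|[a b]] //=; rewrite oppr0. Qed.

Lemma sc_reM z w : sc_re (z * w) = sc_re z * sc_re w - sc_im z * sc_im w.
Proof. by case: k z w => [z w|[a b] [c e]] //=; rewrite mul0r subr0. Qed.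

Lemma sc_imM z w : sc_im (z * w) = sc_re z * sc_im w + sc_im z * sc_re w.
Proof. by case: k z w => [z w|[a b] [c e]] //=; rewrite mul0r mulr0 addr0. Qed.

Lemma sc_re_of_real x : sc_re (sc_of_real k x) = x.
Proof. by case: k. Qed.

Lemma sc_im_of_real x : sc_im (sc_of_real k x) = 0.
Proof. by case: k. Qed.

Lemma sc_abs_of_real x : sc_abs (sc_of_real k x) = `|x|.
Proof. by rewrite sc_absE sc_re_of_real sc_im_of_real expr0n addr0 sqrtr_sqr. Qed.

Lemma sc_absM z w : sc_abs (z * w) = sc_abs z * sc_abs w.
Proof.
rewrite !sc_absE -sqrtrM ?addr_ge0 ?sqr_ge0// sc_reM sc_imM.
by congr Num.sqrt; ring.
Qed.

Lemma sc_absD z w : sc_abs (z + w) <= sc_abs z + sc_abs w.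
Proof.
case: k z w => [z w|z w]; first exact: ler_normD.
have := ler_normD z w; rewrite lecE => /andP[_].
by case: z w => [a b] [c e].
Qed.

Lemma sc_absN z : sc_abs (- z) = sc_abs z.
Proof. by rewrite !sc_absE sc_reN sc_imN !sqrrN. Qed.

Lemma sc_abs_eq0 z : sc_abs z = 0 <-> z = 0.
Proof.
split; last first.
  move=> ->; rewrite (_ : 0 = sc_of_real k 0); first by rewrite sc_abs_of_real normr0.
  by case: (k).
case: k z => [z /eqP|[a b]]; first by rewrite normr_eq0 => /eqP.
move/eqP; rewrite /sc_abs/= sqrtr_eq0 => h.
have a0 : a = 0 by apply/eqP; rewrite -sqrf_eq0 eq_le sqr_ge0 andbT (le_trans _ h)// lerDl sqr_ge0.
have b0 : b = 0 by apply/eqP; rewrite -sqrf_eq0 eq_le sqr_ge0 andbT (le_trans _ h)// lerDr sqr_ge0.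
by rewrite a0 b0.
Qed.

Lemma sc_re_le_abs z : `|sc_re z| <= sc_abs z.
Proof.
by rewrite sc_absE -[leLHS]sqrtr_sqr ler_wsqrtr// lerDl sqr_ge0.
Qed.

Lemma sc_im_le_abs z : `|sc_im z| <= sc_abs z.
Proof.
by rewrite sc_absE -[leLHS]sqrtr_sqr ler_wsqrtr// lerDr sqr_ge0.
Qed.

End scalars.

(** * The function lattice on the half-line *)

Section lattice.
Variables (R : realType) (k : scalar_kind).
Local Notation F := (scalar_field R k).
Local Notation LR := (LebesgueR R).
Implicit Types u v : R -> F.

Definition Leb : {sigma_finite_measure set LR -> \bar R} :=
  @completed_lebesgue_measure R.
Definition toR : LR -> R := idfun.

Lemma measurable_toR : measurable_fun setT toR.
Proof.
move=> _ Y mY; rewrite setTI.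
exact: (@sub_caratheodory _ _ _ (wlength idfun) Y mY).
Qed.

Lemma Leb_toR (t : R) : 0 <= t -> Leb (toR @^-1` `]0, t[) = t%:E.
Proof.
move=> t0; transitivity (lebesgue_measure `]0, t[%classic); first by [].
rewrite lebesgue_measure_itv/= lte_fin; move: t0; rewrite le_eqVlt => /predU1P[<-|->].
  by rewrite ltxx.
by rewrite -EFinB subr0.
Qed.

Definition sabs u : LR -> R := fun x => sc_abs (u x).

Lemma int0t_rearrE u (t : R) : int0t (rearr u) t = rearr_integral Leb toR (sabs u) t.
Proof. by [].  Qed.

Lemma Marcinkiewicz_normE u : Marcinkiewicz_norm u = psi_norm Leb toR (sabs u).
Proof. by []. Qed.

Lemma sabs_ge0 u x : 0 <= sabs u x.
Proof. exact: sc_abs_ge0. Qed.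

Local Notation L0 := (@L0 R k).
Local Notation pos := (half_line toR).

Lemma L0P u : L0 u <-> measurable_fun pos (fun x : LR => sc_re (u x)) /\
  measurable_fun pos (fun x : LR => sc_im (u x)).
Proof. by []. Qed.

Lemma measurable_sabs u : L0 u -> measurable_fun pos (sabs u).
Proof.
move=> /L0P[mre mim].
have -> : sabs u = fun x : LR => Num.sqrt (sc_re (u x) ^+ 2 + sc_im (u x) ^+ 2).
  by apply/funext => x; exact: sc_absE.
apply: measurable_sqrt_comp; apply: measurable_funD; exact: measurable_funX.
Qed.

Lemma L0_cst (z : F) : L0 (fun=> z).
Proof. by apply/L0P; split; exact: measurable_cst. Qed.

Lemma L0D u v : L0 u -> L0 v -> L0 (fun x => u x + v x).
Proof.
move=> /L0P[ru iu] /L0P[rv iv]; apply/L0P; split.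
  under eq_fun do rewrite sc_reD; exact: measurable_funD.
under eq_fun do rewrite sc_imD; exact: measurable_funD.
Qed.

Lemma L0M u v : L0 u -> L0 v -> L0 (fun x => u x * v x).
Proof.
move=> /L0P[ru iu] /L0P[rv iv]; apply/L0P; split.
  under eq_fun do rewrite sc_reM; apply: measurable_funB; exact: measurable_funM.
under eq_fun do rewrite sc_imM; apply: measurable_funD; exact: measurable_funM.
Qed.

Lemma L0_real (f : R -> R) : measurable_fun pos (f : LR -> R) ->
  L0 (fun x => sc_of_real k (f x)).
Proof.
move=> mf; apply/L0P; split.
  by under eq_fun do rewrite sc_re_of_real.
by under eq_fun do rewrite sc_im_of_real; exact: measurable_cst.
Qed.

Variable m : nat -> R.
Hypothesis m_gt0 : forall n, 0 < m n.
Local Notation rs := (rearrangement Leb toR).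
Local Opaque psi_norm sparse rearrangement.
Local Notation sparse := (sparse Leb toR m).
Local Notation psi_norm := (psi_norm Leb toR).

Definition sparse_space : set (R -> F) := [set u | L0 u /\ sparse (sabs u)].
Local Notation X := sparse_space.

Definition sparse_norm u : R := fine (psi_norm (sabs u)).
Local Notation N := sparse_norm.

Lemma sparse_space_fin u : X u -> (psi_norm (sabs u) < +oo)%E.
Proof. by case=> _ /sparse_psi_norm. Qed.

Lemma sparse_space_normE u : X u -> psi_norm (sabs u) = (N u)%:E.
Proof. by move=> Xu; exact: (psi_normE (sparse_space_fin Xu)). Qed.

Lemma le_sparse_norm u v : X u -> X v -> (psi_norm (sabs u) <= psi_norm (sabs v))%E -> N u <= N v.
Proof. by move=> Xu Xv; rewrite (sparse_space_normE Xu) (sparse_space_normE Xv) lee_fin. Qed.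

Lemma sparse_space_le_rearr u v : L0 u -> X v -> (forall t, 0 < t -> (rs (sabs u) t <= rs (sabs v) t)%E) ->
  X u /\ N u <= N v.
Proof.
move=> Lu Xv uv; have [Lv iv] := Xv.
have [Xu nuv] := sparse_le_rearr measurable_toR Leb_toR (measurable_sabs Lu) uv iv.
have XXu : X u by exact: (conj Lu Xu).
split; first exact: XXu.
exact: (le_sparse_norm XXu Xv nuv).
Qed.

Lemma sparse_space_le_ae u v : L0 u -> X v -> ae_pos (fun x => sc_abs (u x) <= sc_abs (v x)) ->
  X u /\ N u <= N v.
Proof.
move=> Lu Xv uv; apply: (sparse_space_le_rearr Lu Xv) => t t0.
apply: (le_rearr_ae measurable_toR _ (measurable_sabs Lu)); last exact: uv.
exact: measurable_sabs Xv.1.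
Qed.

Lemma sparse_space_le u v : L0 u -> X v -> (forall x, sc_abs (u x) <= sc_abs (v x)) ->
  X u /\ N u <= N v.
Proof. by move=> Lu Xv uv; apply: (sparse_space_le_ae Lu Xv); apply: aeW => x _; exact: uv. Qed.

Lemma tame_X u : X u -> tame Leb toR (sabs u).
Proof. by case=> _; exact: (sparse_tame measurable_toR Leb_toR). Qed.

Lemma sparse_space_D u v : X u -> X v -> X (fun x => u x + v x) /\
  N (fun x => u x + v x) <= N u + N v.
Proof.
move=> Xu Xv; have [Lu iu] := Xu; have [Lv iv] := Xv.
have L := L0D Lu Lv.
have tu := tame_X Xu; have tv := tame_X Xv.
have uvle t : 0 < t -> (rs (sabs (fun x => (u x + v x)%R)) t <=
    rs (fun x => sabs u x + sabs v x)%R t)%E.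
  move=> t0; apply: (le_rearr Leb measurable_toR t _ (measurable_sabs L)).
    by move=> x _; exact: sc_absD.
  exact: (tameD measurable_toR tu tv).1.
have s0 w x : 0 <= sabs w x by exact: sc_abs_ge0.
have iD := sparseD measurable_toR Leb_toR m_gt0 iu iv (s0 u) (s0 v).
have [iS nS] := sparse_le_rearr measurable_toR Leb_toR (measurable_sabs L) uvle iD.
have XS : X (fun x => u x + v x) by exact: (conj L iS).
split; first exact: XS.
have := le_trans nS (psi_normD measurable_toR Leb_toR tu tv).
by rewrite (sparse_space_normE XS) (sparse_space_normE Xu) (sparse_space_normE Xv) -EFinD lee_fin.
Qed.

Lemma sparse_space_Z (a : F) u : X u -> X (fun x => a * u x) /\
  N (fun x => a * u x) <= sc_abs a * N u.
Proof.
move=> Xu; have [Lu iu] := Xu; have tu := tame_X Xu.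
have L := L0M (L0_cst a) Lu.
have sE : sabs (fun x => a * u x) = fun x => sc_abs a * sabs u x.
  by apply/funext => x; exact: sc_absM.
have XS : X (fun x => a * u x).
  split; first exact: L.
  rewrite sE; exact: (sparse_scale measurable_toR Leb_toR iu (sc_abs_ge0 a)).
split; first exact: XS.
have := psi_norm_scale_le measurable_toR tu (sc_abs_ge0 a).
by rewrite -sE (sparse_space_normE XS) (sparse_space_normE Xu) -EFinM lee_fin.
Qed.

Lemma ae_posS (P Q : R -> Prop) : (forall x, 0 < x -> P x -> Q x) ->
  ae_pos P -> ae_pos Q.
Proof.
move=> PQ [E [mE E0 PE]]; exists E; split; [exact: mE|exact: E0|].
move=> x /= /existsNP[x0 Qx]; apply: PE => /= Px; exact/Qx/PQ/Px.
Qed.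

Lemma sparse_space_ae0 u : L0 u -> ae_pos (fun x => u x = 0) -> X u /\ N u = 0.
Proof.
move=> Lu u0; have mu_ := measurable_sabs Lu.
have r0 t : 0 < t -> (rs (sabs u) t <= 0%:E)%E.
  move=> t0; apply: (rearr_le_bound measurable_toR mu_ (lexx 0) (ltW t0)).
  by apply: ae_posS u0 => x x0 xu; rewrite /sabs (sc_abs_eq0 _).2 ?xu.
have [iu nu] := sparse0 measurable_toR Leb_toR m_gt0 mu_ r0.
by split; [exact: (conj Lu iu)|rewrite /sparse_norm nu].
Qed.

Lemma X_0 : X (fun=> 0) /\ N (fun=> 0) = 0.
Proof. by apply: sparse_space_ae0; [exact: L0_cst|exact: aeW]. Qed.

Lemma sparse_space_bound u (c : R) : L0 u -> (psi_norm (sabs u) <= c%:E)%E ->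
  ae_pos (fun x => sc_abs (u x) <= c).
Proof. by move=> Lu; exact: (ae_le_psi_norm measurable_toR Leb_toR (measurable_sabs Lu)). Qed.

Lemma sparse_space_norm0 u : X u -> N u = 0 -> ae_pos (fun x => u x = 0).
Proof.
move=> Xu Nu; have : (psi_norm (sabs u) <= 0%:E)%E by rewrite (sparse_space_normE Xu) Nu.
move=> /(sparse_space_bound Xu.1); apply: ae_posS => x _ h; apply/sc_abs_eq0.
by apply/le_anti; rewrite h sc_abs_ge0.
Qed.

Lemma sparse_norm_ge0 u : X u -> 0 <= N u.
Proof. by move=> _; apply: fine_ge0; exact: psi_norm_ge0. Qed.

Lemma sparse_space_B u v : X u -> X v -> X (fun x => u x - v x).
Proof.
move=> Xu Xv; have [XN _] := sparse_space_Z (-1) Xv; have [XD _] := sparse_space_D Xu XN.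
by move: XD; under eq_fun do rewrite mulN1r.
Qed.

End lattice.

(** * Completeness and the lattice axioms *)

Lemma cauchy_real_cvg (R : realType) (a : nat -> R) :
  (forall e, 0 < e -> exists n0, forall i j, (n0 <= i)%N -> (n0 <= j)%N ->
    `|a i - a j| <= e) -> a n @[n --> \oo] --> limn a.
Proof.
move=> h; apply/cauchy_cvgP/cauchy_exP => e e0.
have e2 : 0 < e / 2 by rewrite divr_gt0.
have [n0 hn] := h _ e2; exists (a n0); exists n0 => // n /= n0n.
rewrite /ball/= (le_lt_trans (hn _ _ (leqnn _) n0n))//.
by rewrite ltr_pdivrMr// ltr_pMr// ltr1n.
Qed.

Section completeness.
Variables (R : realType) (k : scalar_kind).
Local Notation F := (scalar_field R k).
Local Notation LR := (LebesgueR R).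
Implicit Types u v : R -> F.
Variable m : nat -> R.
Hypothesis m_gt0 : forall n, 0 < m n.
Local Notation rs := (rearrangement (@Leb R) (@toR R)).
Local Opaque psi_norm sparse rearrangement sparse_norm.
Local Notation sparse := (sparse (@Leb R) (@toR R) m).
Local Notation psi_norm := (psi_norm (@Leb R) (@toR R)).
Local Notation pos := (half_line (@toR R)).
Local Notation X := (@sparse_space R k m).
Local Notation N := (@sparse_norm R k).

Lemma sc_abs_le_sum (z : F) : sc_abs z <= `|sc_re z| + `|sc_im z|.
Proof.
rewrite sc_absE -[leRHS]ger0_norm; last by rewrite addr_ge0.
rewrite -sqrtr_sqr ler_wsqrtr// sqrrD !real_normK ?num_real//.
by rewrite addrAC lerDl mulrn_wge0// mulr_ge0.
Qed.

Lemma sc_re_mk (x y : R) : sc_re (sc_mk k x y) = x.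
Proof. by case: k. Qed.

(** Over the reals both sides vanish, so that real and complex limits are
    handled together. *)
Lemma sc_im_mk_lim (x : R) (z : nat -> F) (c : nat -> R) :
  sc_im (sc_mk k x (limn (fun n => sc_im (z n) * c n))) =
  limn (fun n => sc_im (z n) * c n).
Proof.
case: k z => [z|//] /=; rewrite (_ : (fun n => 0 * c n) = cst 0).
  by rewrite lim_cst.
by apply/funext => n; rewrite mul0r.
Qed.

Lemma ae_pos_forall (P : nat -> R -> Prop) :
  (forall n, ae_pos (P n)) -> ae_pos (fun x => forall n, P n x).
Proof.
move=> h; have := @ae_foralln _ LR R (@Leb R) (fun n x => 0 < (x : R) -> P n x) h.
move=> [E [mE E0 PE]]; exists E; split; [exact: mE|exact: E0|].
by move=> x /= Px; apply: PE => /= Qx; apply: Px => x0 n; exact: Qx.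
Qed.

(** Off a null set the sequence is uniformly Cauchy; once it is set to zero on
    that set, its real and imaginary parts converge everywhere, so that their
    limits are measurable. *)
Lemma ae_uniform_limit (w : nat -> R -> F) : (forall n, L0 (w n)) ->
  (forall e : R, 0 < e -> exists n0, forall i j, (n0 <= i)%N -> (n0 <= j)%N ->
    ae_pos (fun x => sc_abs (w i x - w j x) <= e)) ->
  exists2 l : R -> F, L0 l & forall e : R, 0 < e -> exists n0, forall n,
    (n0 <= n)%N -> ae_pos (fun x => sc_abs (w n x - l x) <= e).
Proof.
move=> Lw cw.
have e_gt0 p : 0 < (p.+1%:R : R)^-1 by rewrite invr_gt0.
have /choice[M hM] (p : nat) : exists q, forall i j, (q <= i)%N -> (q <= j)%N ->
    ae_pos (fun x => sc_abs (w i x - w j x) <= p.+1%:R^-1).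
  exact/cw/e_gt0.
have [B [mB B0 hB]] : ae_pos (fun x => forall p i j, (M p <= i)%N -> (M p <= j)%N ->
    sc_abs (w i x - w j x) <= p.+1%:R^-1).
  apply: ae_pos_forall => p; apply: ae_pos_forall => i; apply: ae_pos_forall => j.
  have [Mi|Mi] := boolP (M p <= i)%N; last first.
    by apply: aeW => x _ Mi'; case/negP: Mi.
  have [Mj|Mj] := boolP (M p <= j)%N; last first.
    by apply: aeW => x _ _ Mj'; case/negP: Mj.
  by apply: ae_posS (hM p i j Mi Mj).
have good x : 0 < x -> ~ B x -> forall p i j, (M p <= i)%N -> (M p <= j)%N ->
    sc_abs (w i x - w j x) <= p.+1%:R^-1.
  by move=> x0 Bx; apply: contrapT => h; apply/Bx/hB => /= /(_ x0).
pose cut (g : F -> R) n (x : LR) : R := g (w n x) * \1_(~` B) x.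
have cut_cauchy (g : F -> R) : (forall z z', `|g z - g z'| <= sc_abs (z - z')) ->
    forall x : LR, 0 < (x : R) -> cut g n x @[n --> \oo] --> limn (cut g ^~ x).
  move=> gL x x0; apply: cauchy_real_cvg => e e0.
  have [p pe] : exists p, p.+1%:R^-1 <= e.
    have [p] := ltr_add_invr e0; rewrite add0r => /ltW pe; by exists p.
  exists (M p) => i j Mi Mj; rewrite /cut -mulrBl normrM indicE.
  have [xB|xB] := pselect (B x).
    by rewrite memNset ?normr0 ?mulr0 ?(ltW e0)//; apply.
  rewrite mem_set// normr1 mulr1; apply: le_trans (gL _ _) _.
  by apply: le_trans pe; exact: good.
have reL (z z' : F) : `|sc_re z - sc_re z'| <= sc_abs (z - z').
  by rewrite -sc_reN -sc_reD sc_re_le_abs.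
have imL (z z' : F) : `|sc_im z - sc_im z'| <= sc_abs (z - z').
  by rewrite -sc_imN -sc_imD sc_im_le_abs.
have mcut (g : F -> R) n : measurable_fun pos (fun x : LR => g (w n x)) ->
    measurable_fun pos (cut g n).
  move=> mg; apply: measurable_funM; first exact: mg.
  by apply: measurable_indic; exact: measurableC.
pose a (x : LR) := limn (cut (@sc_re R k) ^~ x).
pose b (x : LR) := limn (cut (@sc_im R k) ^~ x).
have ma : measurable_fun pos a.
  apply: (@measurable_fun_cvg _ _ _ _ (cut (@sc_re R k))).
    by move=> n; apply: mcut; case: (L0P (w n)).1.
  by move=> x; rewrite half_lineE => x0; exact: cut_cauchy.
have mb : measurable_fun pos b.
  apply: (@measurable_fun_cvg _ _ _ _ (cut (@sc_im R k))).
    by move=> n; apply: mcut; case: (L0P (w n)).1.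
  by move=> x; rewrite half_lineE => x0; exact: cut_cauchy.
pose l (x : R) : F := sc_mk k (a x) (b x).
have imE x : sc_im (l x) = b x by exact: sc_im_mk_lim.
have reE x : sc_re (l x) = a x by exact: sc_re_mk.
exists l.
  apply/L0P; split; [under eq_fun do rewrite reE|under eq_fun do rewrite imE].
    exact: ma.
  exact: mb.
move=> e e0.
have [p pe] : exists p, p.+1%:R^-1 <= e.
  have [p] := ltr_add_invr e0; rewrite add0r => /ltW pe; by exists p.
exists (M p) => n Mn; exists B; split; [exact: mB|exact: B0|].
move=> x /= /existsNP[x0 nx]; apply: contrapT => Bx; apply: nx.
apply: le_trans pe; apply/ler_addgt0Pr => e' e'0.
have e2 : 0 < e' / 2 by rewrite divr_gt0.
have cutE (g : F -> R) i : cut g i x = g (w i x).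
  by rewrite /cut indicE mem_set// mulr1.
have := cut_cauchy _ reL x x0; move/cvgrPdist_le => /(_ _ e2) [i1 _ h1].
have := cut_cauchy _ imL x x0; move/cvgrPdist_le => /(_ _ e2) [i2 _ h2].
pose i := maxn (M p) (maxn i1 i2).
have := h1 i; rewrite /= leq_max leq_max leqnn orbT => /(_ isT) {}h1.
have := h2 i; rewrite /= leq_max leq_max leqnn !orbT => /(_ isT) {}h2.
have -> : w n x - l x = (w n x - w i x) + (w i x - l x) by rewrite addrA subrK.
apply: le_trans (sc_absD _ _) _; apply: lerD.
  by apply: good => //; rewrite leq_max leqnn.
apply: le_trans (sc_abs_le_sum _) _; rewrite (splitr e').
rewrite sc_reD sc_reN sc_imD sc_imN reE imE; apply: lerD.
  by rewrite distrC -(cutE (@sc_re R k)).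
by rewrite distrC -(cutE (@sc_im R k)).
Qed.

(** As the norm dominates the essential supremum, there is a limit [l] that is
    uniform off a null set.  It is also the limit in norm: [psi_norm_limit] transfers
    the Cauchy bound to [w n - l], and [sparse_closed] then puts [l] in the
    space. *)
Lemma sparse_space_complete (w : nat -> R -> F) : (forall n, X (w n)) ->
  (forall e : R, 0 < e -> exists n0 : nat, forall i j : nat,
    (n0 <= i)%N -> (n0 <= j)%N -> N (fun x => w i x - w j x) < e) ->
  exists2 l, X l & (fun n => N (fun x => w n x - l x)) @ \oo --> (0 : R).
Proof.
move=> Xw cw; have Lw n : L0 (w n) by case: (Xw n).
have XB i j := sparse_space_B m_gt0 (Xw i) (Xw j).
have nB i j e : N (fun x => w i x - w j x) <= e ->
    (psi_norm (sabs (fun x => (w i x - w j x)%R)) <= e%:E)%E.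
  by move=> h; rewrite (sparse_space_normE (XB i j)) lee_fin.
have cae e : 0 < e -> exists n0, forall i j, (n0 <= i)%N -> (n0 <= j)%N ->
    ae_pos (fun x => sc_abs (w i x - w j x) <= e).
  move=> /cw [n0 h]; exists n0 => i j ni nj; apply: sparse_space_bound.
    by case: (XB i j).
  by apply: nB; apply: ltW; exact: h.
have [l Ll lw] := ae_uniform_limit Lw cae.
have LD n : L0 (fun x => w n x - l x).
  have := L0D (Lw n) (L0M (L0_cst (-1)) Ll).
  by under eq_fun do rewrite mulN1r.
have key e : 0 < e -> exists n0, forall n, (n0 <= n)%N ->
    (psi_norm (sabs (fun x => (w n x - l x)%R)) <= e%:E)%E.
  move=> e0; have [n0 h0] := cw _ e0; exists n0 => n n0n.
  apply: (psi_norm_limit (@measurable_toR R) (@Leb_toR R) (measurable_sabs (LD n))) => e' e'0.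
  have [n1 h1] := lw _ e'0; pose i := maxn n0 n1.
  exists (sabs (fun x => w n x - w i x)), (sabs (fun x => w i x - l x)); split.
  - exact: (tame_X (XB n i)).
  - exact: measurable_sabs (LD i).
  - by apply: nB; apply: ltW; apply: h0 => //; exact: leq_maxl.
  - by apply: h1; exact: leq_maxr.
  - move=> x _; rewrite /sabs; have -> : w n x - l x = (w n x - w i x) + (w i x - l x).
      by rewrite addrA subrK.
    exact: sc_absD.
have Xl : X l.
  split; first exact: Ll.
  apply: (sparse_closed (@measurable_toR R) (@Leb_toR R) m_gt0 (measurable_sabs Ll)).
    exact: sabs_ge0.
  move=> e /key [n0 /(_ n0 (leqnn _)) h].
  exists (sabs (w n0)), (sabs (fun x => w n0 x - l x)); split.
  - by case: (Xw n0).
  - exact: sabs_ge0.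
  - exact: measurable_sabs (LD n0).
  - exact: sabs_ge0.
  - split; first exact: h.
    move=> x _; rewrite /sabs -[X in sc_abs X <= _](subrK (w n0 x)).
    apply: le_trans (sc_absD _ _) _; rewrite addrC lerD2l.
    by rewrite -sc_absN opprB.
exists l; first exact: Xl.
apply/cvgrPdistC_le => e /key [n0 h]; exists n0 => // n /= /h {}h.
have Xd := sparse_space_B m_gt0 (Xw n) Xl.
rewrite subr0 ger0_norm; last exact: (sparse_norm_ge0 Xd).
by move: h; rewrite (sparse_space_normE Xd) lee_fin.
Qed.

Lemma sparse_space_banach_lattice : banach_lattice X (@sparse_norm R k).
Proof.
split.
- by move=> u [].
- move=> u v Xu Lv uv.
  have vu : ae_pos (fun x => sc_abs (v x) <= sc_abs (u x)).
    by apply: ae_posS uv => x _ ->.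
  have uv' : ae_pos (fun x => sc_abs (u x) <= sc_abs (v x)).
    by apply: ae_posS uv => x _ ->.
  have [Xv Nvu] := sparse_space_le_ae Lv Xu vu; split; first exact: Xv.
  have [_ Nuv] := sparse_space_le_ae Xu.1 Xv uv'.
  by apply: le_anti; apply/andP; split; [exact: Nvu|exact: Nuv].
- exact: (X_0 k m_gt0).1.
- by move=> u v Xu Xv; exact: (sparse_space_D m_gt0 Xu Xv).1.
- by move=> a u Xu; exact: (sparse_space_Z a Xu).1.
- move=> u Xu; have mu_ := measurable_sabs Xu.1.
  apply: (sparse_space_le (L0_real k mu_) Xu _).1 => x.
  by rewrite sc_abs_of_real ger0_norm// sabs_ge0.
- move=> u Xu; have mu_ : measurable_fun pos (fun x : LR => sc_re (u x)).
    by case: ((L0P u).1 Xu.1).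
  apply: (sparse_space_le (L0_real k mu_) Xu _).1 => x.
  by rewrite sc_abs_of_real sc_re_le_abs.
- by move=> u Xu; exact: (sparse_norm_ge0 Xu).
- move=> u Xu; split; first exact: (sparse_space_norm0 Xu).
  by move=> u0; exact: (sparse_space_ae0 m_gt0 Xu.1 u0).2.
- by move=> u v Xu Xv; exact: (sparse_space_D m_gt0 Xu Xv).2.
- move=> a u Xu; apply/le_anti/andP; split; first exact: (sparse_space_Z a Xu).2.
  have [a0|a0] := eqVneq (sc_abs a) 0.
    by rewrite a0 mul0r; exact: (sparse_norm_ge0 (sparse_space_Z a Xu).1).
  have ia : a^-1 * a = 1.
    by rewrite mulVf//; apply: contra_neq a0 => ->; exact/sc_abs_eq0.
  have := (sparse_space_Z a^-1 (sparse_space_Z a Xu).1).2.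
  have -> : (fun x => a^-1 * (a * u x)) = u.
    by apply/funext => x; rewrite mulrA ia mul1r.
  have ia' : sc_abs a^-1 * sc_abs a = 1.
    rewrite -sc_absM ia; rewrite -[RHS](normr1 R) -(sc_abs_of_real k 1).
    by congr sc_abs; case: (k).
  have a_gt0 : 0 < sc_abs a by rewrite lt_neqAle eq_sym a0 sc_abs_ge0.
  move=> /(ler_wpM2l (sc_abs_ge0 a)).
  by rewrite mulrA (mulrC (sc_abs a) (sc_abs a^-1)) ia' mul1r.
- move=> u v Xu Xv uv; exact: (sparse_space_le_ae Xu.1 Xv uv).2.
- exact: sparse_space_complete.
Qed.

Lemma sparse_space_symmetric : symmetric_lattice X (@sparse_norm R k).
Proof.
split; first exact: sparse_space_banach_lattice.
move=> u v Xv Lu uv; exact: (sparse_space_le_rearr Lu Xv uv).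
Qed.

Lemma sparse_space_strongly_symmetric : strongly_symmetric X (@sparse_norm R k).
Proof.
split; first exact: sparse_space_banach_lattice.
move=> u v Xu Xv uv; apply: (le_sparse_norm Xu Xv).
by apply: le_psi_norm => t t0; exact: uv.
Qed.

(** Local integrability of the positive part of the logarithm makes the
    rearrangement of [u] finite, so that [sparse_weyl] applies. *)
Lemma sparse_space_log_submaj u v : X v -> L_log_plus u -> log_submaj u v ->
  X u /\ N u <= N v.
Proof.
move=> Xv [Lu _] [iu _ uv].
have tu := tame_log_integrable (@measurable_toR R) (@Leb_toR R) (measurable_sabs Lu) iu.
have [iXu nuv] := sparse_weyl (@measurable_toR R) (@Leb_toR R) m_gt0 tu Xv.2 iu uv.
have Xu : X u by exact: (conj Lu iXu).
by split; [exact: Xu|exact: (le_sparse_norm Xu Xv nuv)].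
Qed.

End completeness.

(** * The theorem *)

Section step_functions_in_lattice.
Variables (R : realType) (k : scalar_kind).

Lemma sabs_of_real (p : R -> R) : (forall x, 0 <= p x) ->
  sabs (fun x => sc_of_real k (p x)) = p \o @toR R.
Proof.
by move=> p0; apply/funext => x; rewrite /sabs sc_abs_of_real ger0_norm.
Qed.

Lemma L0_decreasing (p : R -> R) : decreasing_on_pos p ->
  L0 (fun x => sc_of_real k (p x)).
Proof.
move=> pd; apply: L0_real.
exact: (measurable_decreasing (@measurable_toR R) pd (@subset_refl _ _)).
Qed.

Let m : nat -> R := @midpoint R.
Local Notation mT := (@measurable_toR R).
Local Notation muT := (@Leb_toR R).

Lemma sparse_space_not_submaj_closed : exists f g : R -> R,
  let F := fun x => sc_of_real k (f x) in
  let G := fun x => sc_of_real k (g x) in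
  nonneg_decreasing f /\ nonneg_decreasing g /\
  @sparse_space R k m F /\ ~ @sparse_space R k m G /\ submaj G F /\
  Marcinkiewicz_norm F = 1%E /\ Marcinkiewicz_norm G = 1%E.
Proof.
(* [32 * cf <= 1] keeps the norm of [f] at 1; the factor 256 is the one used
   in [submaj_steps]. *)
pose cf : R := 32^-1; pose cg : R := cf / 16 / 16.
have cf0 : 0 < cf by rewrite invr_gt0.
have cg0 : 0 < cg by rewrite !divr_gt0.
have cf32 : 32 * cf <= 1 by rewrite mulfV.
have cgf : 16 * (16 * cg) <= cf by rewrite /cg; lra.
have cg32 : 32 * cg <= 1 by apply: le_trans cf32; rewrite -[leRHS]mulr1; lra.
have cfl : cf * 1 <= 1 by rewrite mulr1; lra.
have cgl : cg * 4 <= 1 by lra.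
pose f := step cf (lexx (1 : R)); pose g := step cg (one_le_four R).
have fd : decreasing_on_pos f by exact: step_decreasing.
have gd : decreasing_on_pos g by exact: step_decreasing.
have f0 x : 0 <= f x by exact: step_ge0.
have g0 x : 0 <= g x by exact: step_ge0.
have fE := sabs_of_real f0; have gE := sabs_of_real g0.
have nf := psi_norm_step (lexx 1) cf0 cf32 cfl mT muT.
have ng := psi_norm_step (one_le_four R) cg0 cg32 cgl mT muT.
exists f, g => F G; split; first exact: fd.
split; first exact: gd.
split.
  split; first exact: (L0_decreasing fd).
  rewrite fE; split.
  - exact: (measurable_decreasing mT fd (@subset_refl _ _)).
  - by rewrite nf ltry.
  - exact: (small_f_step cf0 cf32 mT muT).
split.
  case=> _; rewrite gE => -[_ _].
  exact: (not_small_g_step cg0 cf32 cgf mT muT).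
split; last first.
  split; first by rewrite Marcinkiewicz_normE fE; exact: nf.
  by rewrite Marcinkiewicz_normE gE; exact: ng.
move=> t t0.
have hG : (int0t (rearr G) t <= rearr_integral (@Leb R) (@toR R) (g \o @toR R) t)%E.
  rewrite int0t_rearrE gE; exact: lexx.
have hF : (rearr_integral (@Leb R) (@toR R) (f \o @toR R) t <= int0t (rearr F) t)%E.
  rewrite int0t_rearrE fE; exact: lexx.
exact: le_trans hG (le_trans (submaj_steps cf0 cg0 cf32 cgf mT muT t0) hF).
Qed.

End step_functions_in_lattice.

Theorem theorem1p2 (R : realType) (k : scalar_kind) :
  exists (X : set (R -> scalar_field R k)) (N : (R -> scalar_field R k) -> R),
    [/\ symmetric_lattice X N,
        (forall u v : R -> scalar_field R k,
           X v -> L_log_plus u -> log_submaj u v -> X u /\ (N u <= N v)%R),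
        strongly_symmetric X N,
        (exists f g : R -> R,
           let F := fun x => sc_of_real k (f x) in
           let G := fun x => sc_of_real k (g x) in
           nonneg_decreasing f /\ nonneg_decreasing g /\
           X F /\ ~ X G /\ submaj G F /\
           Marcinkiewicz_norm F = 1%E /\ Marcinkiewicz_norm G = 1%E) &
        ~ (exists N' : (R -> scalar_field R k) -> R,
             fully_symmetric X N' /\ equivalent_norms X N N')].
Proof.
pose m := @midpoint R; have m0 := @midpoint_gt0 R.
exists (@sparse_space R k m), (@sparse_norm R k).
have [f [g fgP]] := sparse_space_not_submaj_closed R k.
split.
- exact: (sparse_space_symmetric k m0).
- by move=> u v Xv Lu uv; exact: (sparse_space_log_submaj m0 Xv Lu uv).
- exact: (sparse_space_strongly_symmetric k m0).
- by exists f, g; exact: fgP.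
- have [_ [gd [Xf [Xg [gf _]]]]] := fgP.
  move=> [N' [[_ full] _]]; apply: Xg.
  exact: (full _ _ (L0_decreasing k gd) Xf gf).1.
Qed.
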